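(* Let $r\ge 1$ be an integer, let $x,x_1,\ldots,x_r$ be roots of unity, and let $p_1,\ldots,p_r,q\ge 1$ be integers with $(p_j,x_j)\neq(1,1)$ for all $j=1,\ldots,r$ and $(q,x)\neq(1,1)$. Then $$T_{p_1,\ldots,p_r;q}(x_1,\ldots,x_r;x)\equiv(-1)^{p_1+\cdots+p_r+q+r-1}\,(x\,x_1\cdots x_r)\,T_{p_1,\ldots,p_r;q}\big(x_1^{-1},\ldots,x_r^{-1};x^{-1}\big)\pmod{\text{products}},$$ that is, the difference of the two sides is a finite linear combination, with coefficients in the cyclotomic field $\mathbb{Q}(x,x_1,\ldots,x_r)$, of products of cyclotomic Euler sums and cyclotomic Euler $T$-sums, all factors having order less than $r$.
   Context: For a positive integer $p$, $n\ge 0$ and a root of unity $z$ put $t_n(p;z):=\sum_{k=1}^n \frac{z^k}{(k-1/2)^p}$ and $\zeta_n(p;z):=\sum_{k=1}^n\frac{z^k}{k^p}$. For $k\ge 0$, positive integers $p_1,\ldots,p_k,q$ and roots of unity $x_1,\ldots,x_k,x$ with $(q,x)\ne(1,1)$: - the cyclotomic Euler $T$-sum of order $k$ is $T_{p_1,\ldots,p_k;q}(x_1,\ldots,x_k;x):=\sum_{n=1}^\infty \frac{t_n(p_1;x_1)\cdots t_n(p_k;x_k)}{(n-1/2)^q}x^n$; - the cyclotomic Euler sum of order $k$ is $S_{p_1,\ldots,p_k;q}(x_1,\ldots,x_k;x):=\sum_{n=1}^\infty \frac{\zeta_n(p_1;x_1)\cdots \zeta_n(p_k;x_k)}{n^q}x^n$.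 For $k=0$ these are $T_{\emptyset;q}(\emptyset;x)=\sum_{n\ge1}\frac{x^n}{(n-1/2)^q}$ and $S_{\emptyset;q}(\emptyset;x)=\sum_{n\ge1}\frac{x^n}{n^q}$. The factors allowed in the products may have arbitrary roots of unity as arguments. A product may consist of a single factor. *)

(* Defs.v *)
From HB Require Import structures.
From mathcomp Require Import all_boot all_order all_algebra.
From mathcomp Require Import complex.
From mathcomp Require Import all_classical all_reals all_analysis.

Set Implicit Arguments.
Unset Strict Implicit.
Unset Printing Implicit Defensive.

Import Order.TTheory GRing.Theory Num.Theory.
Import numFieldNormedType.Exports.

Local Open Scope classical_set_scope.
Local Open Scope ring_scope.

Definition is_root_of_unity (R : realType) (z : R[i]) : Prop :=
  exists2 m : nat, (0 < m)%N & m.-unity_root z.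

Definition tsum (R : realType) (p : nat) (z : R[i]) (n : nat) : R[i] :=
  \sum_(1 <= k < n.+1) z ^+ k / (k%:R - 2^-1) ^+ p.

Definition zetasum (R : realType) (p : nat) (z : R[i]) (n : nat) : R[i] :=
  \sum_(1 <= k < n.+1) z ^+ k / k%:R ^+ p.

(* The limits are taken in R[i]^o, that is in R[i] with the topology of the
   complex modulus.  They exist when [x] and the [xs j] are roots of unity, [q]
   and the [p j] are positive, and (q, x) <> (1, 1); the series converge only
   conditionally in general, hence the ordered partial sums. *)
Definition euler_T (R : realType) (k : nat) (p : 'I_k -> nat) (q : nat)
    (xs : 'I_k -> R[i]) (x : R[i]) : R[i] :=
  limn (fun N : nat => \sum_(1 <= n < N.+1)
    (\prod_(j < k) tsum (p j) (xs j) n) / (n%:R - 2^-1) ^+ q * x ^+ n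
    : R[i]^o).

Definition euler_S (R : realType) (k : nat) (p : 'I_k -> nat) (q : nat)
    (xs : 'I_k -> R[i]) (x : R[i]) : R[i] :=
  limn (fun N : nat => \sum_(1 <= n < N.+1)
    (\prod_(j < k) zetasum (p j) (xs j) n) / n%:R ^+ q * x ^+ n
    : R[i]^o).

(* The pairs (p j, xs j) = (1, 1) are allowed: only (q, x) matters for
   convergence. *)
Definition euler_admissible (R : realType) (k : nat) (p : 'I_k -> nat)
    (q : nat) (xs : 'I_k -> R[i]) (x : R[i]) : Prop :=
  [/\ forall j, (0 < p j)%N /\ is_root_of_unity (xs j),
      (0 < q)%N, is_root_of_unity x & (q, x) <> (1%N, 1)].

Definition euler_sum_lt (R : realType) (r : nat) : set R[i] :=
  [set v | exists k (p : 'I_k -> nat) q (xs : 'I_k -> R[i]) (x : R[i]),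
     [/\ (k < r)%N, euler_admissible p q xs x &
         v = euler_T p q xs x \/ v = euler_S p q xs x]].

(* Q(A): a subfield of characteristic 0 contains Q. *)
Definition Qadjoin (R : realType) (A : set R[i]) : set R[i] :=
  smallest (fun K : set R[i] => divring_closed (mem K)) A.

(* Each monomial [f i] has at least one factor; the sum over [i] may be
   empty. *)
Definition eqmod_products (R : realType) (K : set R[i]) (r : nat)
    (a b : R[i]) : Prop :=
  exists (m : nat) (c : 'I_m -> R[i]) (f : 'I_m -> seq R[i]),
    [/\ forall i, K (c i),
        forall i, f i <> [::] /\ forall v, v \in f i -> euler_sum_lt r v &
        a - b = \sum_(i < m) c i * \prod_(v <- f i) v].

(* Main.v *)
Require Import Defs.
From HB Require Import structures.
From mathcomp Require Import all_boot all_order all_algebra.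
From mathcomp Require Import complex.
From mathcomp Require Import all_classical all_reals all_analysis.
From mathcomp Require Import ring lra zify.

Set Implicit Arguments.
Unset Strict Implicit.
Unset Printing Implicit Defensive.

Import Order.TTheory GRing.Theory Num.Theory.
Import numFieldNormedType.Exports.
Import ComplexField.Normc.

Local Open Scope classical_set_scope.
Local Open Scope ring_scope.

(** Write the terms of the T-sum with a = n - 1/2.  The substitution n -> 1 - n
    turns a into - a, so the right-hand side of the congruence is, up to sign,
    the part over n <= 0 of one sum over all integers,

      sum over n in Z of x^n / (n - 1/2)^q * prod_j W_j(n),
      W_j(n) = sum over k <= n of x_j^k / (k - 1/2)^(p_j).

    Indeed W_j(n) is an inner sum of length n plus a constant for n > 0, and a
    constant minus an inner sum for n <= 0; expanding the product, every term
    other than the two leading ones has lost an inner sum and is a product of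
    sums of order less than r.  It remains to see that the sum over Z itself is
    made of such products.

    With y = x x_1 ... x_r the summand is y^n f(n - 1/2), where

      f(s) = s^(-q) prod_j (sum over l >= 0 of x_j^(-l) / (s - l)^(p_j))

    has its poles at the integers m >= 0.  If f is replaced by its principal
    part at m, the sum over n is translation invariant up to a power of y: it is
    y^m times a sum of order 0.  The coefficients of the principal part come from
    the Laurent expansions at m of the factors, whose coefficients are the sums
    zeta_m, up to constants, so that the sum over m is a combination of Euler
    sums.  Their order is less than r, because a pole at m > 0 requires that one
    of the factors contributes its singular part, which involves no inner sum.

    All series converge only conditionally, so the factors are truncated at
    l <= M.  Then f is a rational function and partial_fractions applies; for
    fixed M the sum over n is evaluated by bilateral_pole.  As M grows, the
    truncation errors are O(1/(M - n)) while the terms are O((log n)^k / n), and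
    the discrete convolution of the two tends to 0 (sum_inv_conv, filt_limit).
    This governs both the sum over the poles (residue_sum_cvg) and the sums over
    n > 0 and n <= 0 (positive_side, negative_side); the range |n| > M is
    controlled by bilateral_far. *)

(** * Limits of complex sequences *)

Section ComplexLimits.
Variable R : realType.
Local Notation C := R[i].

Lemma normc_ge0 (z : C) : 0 <= normc z.
Proof. by case: z => a b; exact: sqrtr_ge0. Qed.

Lemma normcX (z : C) n : normc (z ^+ n) = normc z ^+ n.
Proof. by elim: n => [|n IH]; rewrite ?normc1 // !exprS normcM IH. Qed.

Lemma normc_real (a : R) : normc a%:C%C = `|a|.
Proof. by rewrite /= expr0n /= addr0 sqrtr_sqr. Qed.

Lemma normc_sum (I : Type) (s : seq I) (P : pred I) (F : I -> C) :
  normc (\sum_(i <- s | P i) F i) <= \sum_(i <- s | P i) normc (F i).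
Proof.
elim/big_rec2: _ => [|i a b _ le_ba]; first by rewrite normc0.
by apply: le_trans (le_normcD _ _) _; rewrite lerD2l.
Qed.

Lemma normcB (y z : C) : normc (y - z) = normc (z - y).
Proof. by rewrite -normcN opprB. Qed.

Lemma normc_prod (I : Type) (s : seq I) (P : pred I) (F : I -> C) :
  normc (\prod_(i <- s | P i) F i) = \prod_(i <- s | P i) normc (F i).
Proof. by apply: (big_morph _ (@normcM R) (@normc1 R)). Qed.

Lemma normr_normc (z : C) : `|z| = (normc z)%:C%C.
Proof. by case: z. Qed.

(** R[i]^o carries the topology of the modulus. *)
Definition tends (u : nat -> C) (l : C) : Prop :=
  (u : nat -> R[i]^o) @ \oo --> (l : R[i]^o).

Lemma tendsP (u : nat -> C) l :
  tends u l <-> (fun n => normc (u n - l)) @ \oo --> (0 : R).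
Proof.
split=> [/cvgrPdist_lt ul|/cvgrPdist_lt ul]; apply/cvgrPdist_lt => e e0.
  have e0' : 0 < e%:C%C :> R[i]^o by rewrite ltcR.
  near=> n; rewrite sub0r normrN ger0_norm ?normc_ge0 // -ltcR normcB -normr_normc.
  by near: n; exact: (ul _ e0').
have [eR e0'] : e = (complex.Re e)%:C%C /\ 0 < complex.Re e.
  by case: e e0 => a b; rewrite ltcE /= => /andP[/eqP -> ->].
near=> n; rewrite /= normr_normc eR ltcR normcB.
have : `|0 - normc (u n - l)| < complex.Re e by near: n; exact: ul.
by rewrite sub0r normrN ger0_norm ?normc_ge0.
Unshelve. all: by end_near. Qed.

Lemma tends_squeeze (u : nat -> C) l (e : nat -> R) :
  (forall n, normc (u n - l) <= e n) -> e @ \oo --> (0 : R) -> tends u l.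
Proof.
move=> ue e0; apply/tendsP; apply: (squeeze_cvgr _ (cvg_cst 0) e0).
by near=> n; rewrite normc_ge0 ue.
Unshelve. all: by end_near. Qed.

Lemma tends_cst l : tends (fun=> l) l. Proof. exact: cvg_cst. Qed.

Lemma tendsD u v a b : tends u a -> tends v b -> tends (fun n => u n + v n) (a + b).
Proof. by move=> ua vb; apply: (@cvgD _ R[i]^o nat \oo _ _ _ _ _ ua vb). Qed.

Lemma tendsM u v a b : tends u a -> tends v b -> tends (fun n => u n * v n) (a * b).
Proof. by move=> ua vb; apply: (@cvgM R[i] nat \oo _ _ _ _ _ ua vb). Qed.

Lemma tendsZ c u a : tends u a -> tends (fun n => c * u n) (c * a).
Proof. move=> ua; apply: tendsM; [exact: tends_cst | exact: ua]. Qed.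

Lemma tendsN u a : tends u a -> tends (fun n => - u n) (- a).
Proof. by move=> /(tendsZ (c := -1)); rewrite mulN1r; under eq_fun do rewrite mulN1r. Qed.

Lemma tendsB u v a b : tends u a -> tends v b -> tends (fun n => u n - v n) (a - b).
Proof. by move=> ua /tendsN; exact: tendsD. Qed.

Lemma tends_sum (I : Type) (s : seq I) (P : pred I) (u : I -> nat -> C) (a : I -> C) :
  (forall i, P i -> tends (u i) (a i)) ->
  tends (fun n => \sum_(i <- s | P i) u i n) (\sum_(i <- s | P i) a i).
Proof.
move=> ua; elim: s => [|i s IH].
  by under eq_fun do rewrite big_nil; rewrite big_nil; exact: tends_cst.
under eq_fun do rewrite big_cons; rewrite big_cons.
case: ifP => Pi; last exact: IH.
by apply: tendsD; [exact: ua | exact: IH].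
Qed.

Lemma tends_lim (u : nat -> C) l : tends u l -> limn (u : nat -> R[i]^o) = l.
Proof. by move=> ul; apply: cvg_lim => //; exact: norm_hausdorff. Qed.

Lemma tends_unique (u : nat -> C) a b : tends u a -> tends u b -> a = b.
Proof. by move=> /tends_lim <- /tends_lim. Qed.

Lemma tends_shift (u : nat -> C) l k : tends u l -> tends (fun n => u (n + k)%N) l.
Proof. by rewrite /tends -(cvg_shiftn k (u : nat -> R[i]^o)). Qed.

Lemma tends_eventually (u v : nat -> C) l M :
  (forall n, (M <= n)%N -> u n = v n) -> tends u l -> tends v l.
Proof.
move=> uv /(tends_shift M).
rewrite /tends -(cvg_shiftn M (v : nat -> R[i]^o)).
by under eq_fun do rewrite uv ?leq_addl //.
Qed.

Lemma tends_norm_le (u : nat -> C) l (c : C) (b : R) M :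
  tends u l -> (forall n, (M <= n)%N -> normc (u n - c) <= b) ->
  normc (l - c) <= b.
Proof.
move=> /tendsP ul ub.
apply/ler_addgt0Pl => e e0.
have /cvgrPdist_lt/(_ _ e0)[N _ ulN] := ul.
have /= := ulN (maxn N M) (leq_maxl _ _).
rewrite sub0r normrN ger0_norm ?normc_ge0 // => uln.
have := ub _ (leq_maxr N M) => ubn.
have -> : l - c = - (u (maxn N M) - l) + (u (maxn N M) - c) by ring.
apply: le_trans (le_normcD _ _) _; rewrite normcN.
by apply: lerD => //; exact: ltW.
Qed.

(** Completeness is inherited from the real line through the real and imaginary
    parts. *)
Lemma tends_absolute (a : nat -> C) (B : R) :
  (forall N, \sum_(0 <= n < N) normc (a n) <= B) ->
  exists l, tends (fun N => \sum_(0 <= n < N) a n) l.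
Proof.
move=> aB.
have part (f : C -> R) : (forall z, `|f z| <= normc z) ->
    cvgn (series (fun n => f (a n))).
  move=> fle; apply: normed_cvg; apply: nondecreasing_is_cvgn.
    apply: nondecreasing_series => n _ _; exact: normr_ge0.
  exists B => _ [N _ <-]; apply: le_trans (aB N).
  by apply: ler_sum => i _; exact: fle.
have Rele (z : C) : `|complex.Re z| <= normc z.
  by rewrite -lecR -normr_normc; exact: normc_ge_Re.
have Imle (z : C) : `|complex.Im z| <= normc z.
  case: z => x y /=; rewrite -sqrtr_sqr; apply: ler_wsqrtr.
  by rewrite lerDr sqr_ge0.
have /cvg_ex[x ax] := part _ Rele.
have /cvg_ex[y ay] := part _ Imle.
exists (x +i* y)%C; apply: (@tends_squeeze _ _
  (fun N => `|series (fun n => complex.Re (a n)) N - x|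
     + `|series (fun n => complex.Im (a n)) N - y|)).
  move=> N.
  have -> : \sum_(0 <= n < N) a n - (x +i* y)%C =
     (series (fun n => complex.Re (a n)) N - x)%:C%C
     + 'i%C * (series (fun n => complex.Im (a n)) N - y)%:C%C.
    rewrite !rmorphB /= /series /= !rmorph_sum /= mulrBr mulr_sumr.
    rewrite (complexE (x +i* y)%C) /= opprD addrACA -big_split /=.
    by congr (_ + _); apply: eq_bigr => i _; rewrite -complexE.
  apply: le_trans (le_normcD _ _) _; rewrite normcM !normc_real.
  by rewrite /= expr0n add0r expr1n sqrtr1 mul1r.
rewrite -[0]addr0; apply: cvgD.
  by apply/norm_cvg0P/subr_cvg0.
by apply/norm_cvg0P/subr_cvg0.
Qed.

End ComplexLimits.

(** * Powers of harmonic numbers *)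

Section Growth.
Variable R : realType.

Definition harm (n : nat) : R := \sum_(1 <= k < n.+1) k%:R^-1.

Lemma harmS n : harm n.+1 = harm n + n.+1%:R^-1.
Proof. by rewrite /harm big_nat_recr. Qed.

Lemma harm_ge0 n : 0 <= harm n.
Proof. by apply: sumr_ge0 => k _; rewrite invr_ge0 ler0n. Qed.

Lemma harm_mono m n : (m <= n)%N -> harm m <= harm n.
Proof.
move=> /subnK <-; elim: (n - m)%N => // d IH; rewrite addSn harmS.
by apply: le_trans IH _; rewrite lerDl invr_ge0 ler0n.
Qed.

Lemma harm_ge1 n : (0 < n)%N -> 1 <= harm n.
Proof.
move=> n0; apply: le_trans (harm_mono n0).
by rewrite /harm big_nat1 invr1.
Qed.

Lemma subrX_le (a b : R) k : 0 <= b -> b <= a ->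
  a ^+ k.+1 - b ^+ k.+1 <= k.+1%:R * (a - b) * a ^+ k.
Proof.
move=> b0 ba; have a0 := le_trans b0 ba.
elim: k => [|k IH]; first by rewrite !expr1 expr0 mulr1 mul1r.
have -> : a ^+ k.+2 - b ^+ k.+2 =
    a * (a ^+ k.+1 - b ^+ k.+1) + (a - b) * b ^+ k.+1.
  by rewrite (exprS a k.+1) (exprS b k.+1); ring.
have -> : k.+2%:R * (a - b) * a ^+ k.+1 =
    a * (k.+1%:R * (a - b) * a ^+ k) + (a - b) * a ^+ k.+1.
  by rewrite -(natr1 k.+1) (exprS a k); ring.
apply: lerD; first exact: ler_wpM2l.
by apply: ler_wpM2l; rewrite ?subr_ge0 // lerXn2r.
Qed.

Lemma invn_gap n :
  n.+1%:R^-1 ^+ 2 <= 2 * (n.+1%:R^-1 - n.+2%:R^-1) :> R.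
Proof.
have a0 : 0 < n.+1%:R :> R by rewrite ltr0n.
have -> : n.+1%:R^-1 - n.+2%:R^-1 = n.+1%:R^-1 * n.+2%:R^-1 :> R.
  by rewrite -(natr1 n.+1); field; rewrite !gt_eqF // addr_gt0.
rewrite expr2 mulrCA ler_pM2l ?invr_gt0 //.
rewrite -(natr1 n.+1) ler_pdivlMr ?addr_gt0 // mulrDr mulVf ?gt_eqF // mulr1.
by rewrite [leRHS]mulr2n lerD2l invf_le1 // ler1n.
Qed.

(** One step increases harm ^+ k.+1 by at most (k + 1) / n * harm ^+ k, so that
    summation by parts bounds the sum for k + 1 by a multiple of the sum for k.
    The boundary term is kept because it shows, in the same induction, that
    powers of harm grow at most linearly. *)
Lemma harm_pow_bound k : exists2 B : R, 0 <= B &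
  forall N, \sum_(1 <= n < N.+1) harm n ^+ k * (n%:R^-1 - n.+1%:R^-1)
            + harm N ^+ k * N.+1%:R^-1 <= B.
Proof.
elim: k => [|k [B B0 IH]].
  exists 1 => // N; elim: N => [|N IH].
    by rewrite big_geq // expr0 invr1 mulr1 add0r.
  apply: le_trans IH; rewrite big_nat_recr //= !expr0 !mul1r -addrA subrK.
  by under eq_bigr do rewrite expr0.
exists (2 * k.+1%:R * B); first by rewrite !mulr_ge0.
move=> N.
apply: (@le_trans _ _ (2 * k.+1%:R *
   \sum_(1 <= n < N.+1) harm n ^+ k * (n%:R^-1 - n.+1%:R^-1))); last first.
  apply: ler_wpM2l; first by rewrite mulr_ge0.
  apply: le_trans (IH N); rewrite lerDl mulr_ge0 // ?invr_ge0 ?ler0n //.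
  by rewrite exprn_ge0 // harm_ge0.
elim: N => [|N IHN].
  by rewrite !big_geq // mulr0 /harm big_geq // expr0n mul0r addr0.
rewrite big_nat_recr //= [in leRHS]big_nat_recr //=.
set S := \sum_(1 <= i < N.+1) _ in IHN *; set S' := \sum_(1 <= i < N.+1) _ in IHN *.
have -> : S + harm N.+1 ^+ k.+1 * (N.+1%:R^-1 - N.+2%:R^-1) +
          harm N.+1 ^+ k.+1 / N.+2%:R =
   (S + harm N ^+ k.+1 / N.+1%:R)
   + (harm N.+1 ^+ k.+1 - harm N ^+ k.+1) / N.+1%:R by ring.
rewrite [leRHS]mulrDr.
apply: lerD => //.
apply: (@le_trans _ _ (k.+1%:R * (harm N.+1 - harm N) * harm N.+1 ^+ k / N.+1%:R)).
  rewrite ler_wpM2r ?invr_ge0 ?ler0n // subrX_le ?harm_ge0 //.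
  exact: harm_mono.
rewrite harmS addrAC subrr add0r -harmS.
have := invn_gap N; set u := _ ^+ 2 => ugap.
have -> : k.+1%:R * N.+1%:R^-1 * harm N.+1 ^+ k / N.+1%:R =
  k.+1%:R * harm N.+1 ^+ k * u by rewrite /u; ring.
have -> : 2 * k.+1%:R * (harm N.+1 ^+ k * (N.+1%:R^-1 - N.+2%:R^-1)) =
  k.+1%:R * harm N.+1 ^+ k * (2 * (N.+1%:R^-1 - N.+2%:R^-1)) by ring.
by rewrite ler_wpM2l // mulr_ge0 ?exprn_ge0 ?harm_ge0.
Qed.

Lemma harm_pow_summable k : exists2 B : R, 0 <= B &
  forall N, \sum_(1 <= n < N.+1) harm n ^+ k * n%:R^-1 ^+ 2 <= B.
Proof.
have [B B0 HB] := harm_pow_bound k; exists (2 * B); first by rewrite mulr_ge0.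
move=> N; apply: (@le_trans _ _
  (2 * \sum_(1 <= n < N.+1) harm n ^+ k * (n%:R^-1 - n.+1%:R^-1))).
  rewrite mulr_sumr !big_add1 /=; apply: ler_sum => n _.
  rewrite [leRHS]mulrCA ler_wpM2l ?exprn_ge0 ?harm_ge0 //; exact: invn_gap.
rewrite ler_pM2l //; apply: le_trans (HB N).
by rewrite lerDl mulr_ge0 ?exprn_ge0 ?harm_ge0 // invr_ge0 ler0n.
Qed.

Lemma harm_pow_le k : exists2 B : R, 0 <= B &
  forall N, harm N ^+ k <= B * N.+1%:R.
Proof.
have [B B0 HB] := harm_pow_bound k; exists B => // N.
rewrite -ler_pdivrMr ?ltr0n //; apply: le_trans (HB N).
rewrite lerDr; rewrite big_add1 /=; apply: sumr_ge0 => n _.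
rewrite mulr_ge0 ?exprn_ge0 ?harm_ge0 // subr_ge0 lef_pV2 ?posrE ?ltr0n //.
by rewrite ler_nat.
Qed.

Lemma harm_pow_over_cvg0 (B : R) k :
  (fun N => B * (harm N ^+ k * N.+1%:R^-1)) @ \oo --> (0 : R).
Proof.
rewrite -[X in _ --> X](mulr0 B); apply: cvgMr.
have [D D0 HD] := harm_pow_le (2 * k)%N.
(* As harm N ^+ (2 * k) = O(N), the quotient is O(1 / sqrt N). *)
have lim0 : (fun N => Num.sqrt D * Num.sqrt (harmonic N)) @ \oo --> (0 : R).
  rewrite -[X in _ --> X](mulr0 (Num.sqrt D)); apply: cvgMr.
  rewrite -[X in _ --> X]sqrtr0.
  by apply: continuous_cvg; [exact: sqrt_continuous | exact: cvg_harmonic].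
apply: (squeeze_cvgr _ (cvg_cst 0) lim0).
near=> N; rewrite mulr_ge0 ?exprn_ge0 ?harm_ge0 ?invr_ge0 ?ler0n //=.
rewrite -sqrtrM // -(@ler_pXn2r _ 2) ?nnegrE ?sqrtr_ge0 ?mulr_ge0 ?exprn_ge0
  ?harm_ge0 ?invr_ge0 ?ler0n //.
rewrite sqr_sqrtr ?mulr_ge0 ?invr_ge0 ?ler0n // exprMn -exprM mulnC.
rewrite expr2 mulrA; apply: ler_wpM2r; first by rewrite invr_ge0 ler0n.
by rewrite ler_pdivrMr ?ltr0n.
Unshelve. all: by end_near. Qed.

(** The discrete convolution of 1/n with itself decays like log N / N: split
    1/(n (N - n + 1)) by partial fractions. *)
Lemma sum_inv_conv N :
  \sum_(1 <= n < N.+1) n%:R^-1 * (N - n).+1%:R^-1 =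
  2 * harm N * N.+1%:R^-1 :> R.
Proof.
have -> : \sum_(1 <= n < N.+1) n%:R^-1 * (N - n).+1%:R^-1 =
   \sum_(1 <= n < N.+1) (n%:R^-1 + (N - n).+1%:R^-1) * N.+1%:R^-1 :> R.
  apply: eq_big_nat => n /andP[n1 nN].
  have -> : N.+1%:R = n%:R + (N - n).+1%:R :> R by rewrite -natrD; congr _%:R; lia.
  have n0 : 0 < n%:R :> R by rewrite ltr0n.
  have m0 : 0 < (N - n).+1%:R :> R by rewrite ltr0n.
  by field; rewrite !gt_eqF // addr_gt0.
rewrite -mulr_suml big_split /= -/(harm N).
have -> : 2 * harm N = harm N + harm N by ring.
congr ((_ + _) * _).
rewrite big_nat_rev /= /harm; apply: eq_big_nat => n /andP[n1 nN].
by congr (_%:R^-1); lia.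
Qed.

Lemma sum_inv_tail M N : (0 < M)%N ->
  \sum_(M.+1 <= n < N.+1) n%:R^-1 * (n - M)%:R^-1 <= harm M * M%:R^-1 :> R.
Proof.
move=> M0; have M0' : 0 < M%:R :> R by rewrite ltr0n.
have [NM|MN] := leqP N M.
  by rewrite big_geq ?ltnS // mulr_ge0 ?harm_ge0 // invr_ge0 ler0n.
have key : \sum_(M.+1 <= n < N.+1) n%:R^-1 * (n - M)%:R^-1 =
   (harm (N - M) - (harm N - harm M)) * M%:R^-1 :> R.
  move: MN => /ltnW/subnK <-; elim: (N - M)%N => [|d IH].
    by rewrite add0n subnn big_geq // subrr /harm big_geq // subr0 mul0r.
  rewrite addSn big_nat_recr ?ltnS ?leq_addl //= IH.
  rewrite (_ : (d + M).+1 - M = d.+1)%N; last by lia.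
  rewrite (_ : d + M - M = d)%N; last by lia.
  rewrite !harmS -(natr1 (d + M)) natrD.
  have -> : d%:R + M%:R + 1 = d.+1%:R + M%:R :> R by rewrite -(natr1 d); ring.
  have d0 : 0 < d.+1%:R :> R by rewrite ltr0n.
  by field; rewrite !gt_eqF // addr_gt0.
rewrite key ler_wpM2r ?invr_ge0 ?ler0n //.
by have := @harm_mono (N - M) N (leq_subr _ _); lra.
Qed.

End Growth.

(** * Euler sums and T-sums: convergence and tails *)

Section ShiftedSums.
Variable R : realType.
Local Notation C := R[i].
Local Notation harm := (harm R).

Lemma root_of_unity_normc (z : C) : is_root_of_unity z -> normc z = 1.
Proof.
case=> m m0 /unity_rootP zm; apply/eqP.
by rewrite -(@pexpr_eq1 _ _ m) ?normc_ge0 // -normcX zm normc1.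
Qed.

Lemma root_of_unity_neq0 (z : C) : is_root_of_unity z -> z != 0.
Proof.
move=> /root_of_unity_normc z1; apply/eqP => z0.
by move: z1; rewrite z0 normc0 => /esym/eqP; rewrite oner_eq0.
Qed.

Lemma root_of_unity1 : is_root_of_unity (1 : C).
Proof. by exists 1%N => //; apply/unity_rootP; rewrite expr1. Qed.

Lemma root_of_unityM (y z : C) :
  is_root_of_unity y -> is_root_of_unity z -> is_root_of_unity (y * z).
Proof.
move=> [m m0 /unity_rootP ym] [n n0 /unity_rootP zn].
exists (m * n)%N; first by rewrite muln_gt0 m0.
by apply/unity_rootP; rewrite exprMn exprM ym mulnC exprM zn !expr1n mulr1.
Qed.

Lemma root_of_unityV (z : C) : is_root_of_unity z -> is_root_of_unity z^-1.
Proof.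
by move=> [m m0 /unity_rootP zm]; exists m => //; apply/unity_rootP; rewrite exprVn zm invr1.
Qed.

(** Euler sums and Euler T-sums only differ by the offset of the denominators,
    so that both are treated at once. *)
Definition offset (b : bool) : C := if b then 2^-1 else 0.

Definition offsetR (b : bool) : R := if b then 2^-1 else 0.

Lemma offsetE b : offset b = (offsetR b)%:C%C.
Proof. by case: b; rewrite /= ?rmorph0 // fmorphV rmorph_nat. Qed.

Lemma natr_offset b n : n%:R - offset b = (n%:R - offsetR b)%:C%C.
Proof. by rewrite offsetE rmorphB /= rmorph_nat. Qed.

Lemma offsetR_bounds b : 0 <= offsetR b <= 2^-1.
Proof. by case: b => /=; lra. Qed.

Lemma natr_offsetR_gt0 b n : 0 < n.+1%:R - offsetR b.
Proof.
have /andP[h0 h1] := offsetR_bounds b.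
have : 1 <= n.+1%:R :> R by rewrite ler1n.
lra.
Qed.

Lemma natr_offset_neq0 b n : n.+1%:R - offset b != 0.
Proof.
rewrite natr_offset -(rmorph0 (real_complex R)) (inj_eq (fmorph_inj _)).
by rewrite gt_eqF // natr_offsetR_gt0.
Qed.

Lemma normc_offsetV b n :
  normc (n.+1%:R - offset b)^-1 = (n.+1%:R - offsetR b)^-1.
Proof. by rewrite normcV natr_offset normc_real gtr0_norm // natr_offsetR_gt0. Qed.

Lemma normc_offsetV_le b n : normc (n.+1%:R - offset b)^-1 <= 2 * n.+1%:R^-1.
Proof.
have /andP[h0 h1] := offsetR_bounds b.
have n1 : 1 <= n.+1%:R :> R by rewrite ler1n.
rewrite normc_offsetV ler_pdivlMr ?(lt_le_trans ltr01) //.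
by rewrite mulrC ler_pdivrMr ?natr_offsetR_gt0 //; lra.
Qed.

Lemma normc_offsetVX_le b n q : (0 < q)%N ->
  normc ((n.+1%:R - offset b) ^+ q)^-1 <= 2 ^+ q * n.+1%:R^-1.
Proof.
case: q => // q _; rewrite -exprVn normcX.
apply: (@le_trans _ _ ((2 * n.+1%:R^-1) ^+ q.+1)).
  by rewrite lerXn2r ?nnegrE ?normc_ge0 ?mulr_ge0 ?invr_ge0 ?ler0n ?normc_offsetV_le.
rewrite exprMn ler_wpM2l ?exprn_ge0 // exprS -[leRHS]mulr1.
rewrite ler_wpM2l ?invr_ge0 ?ler0n // exprn_ile1 ?invr_ge0 ?ler0n //.
by rewrite invf_le1 ?ler1n ?ltr0n.
Qed.

Lemma normc_offsetVX2_le b n q : (1 < q)%N ->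
  normc ((n.+1%:R - offset b) ^+ q)^-1 <= 2 ^+ q * n.+1%:R^-1 ^+ 2.
Proof.
case: q => // q q0; rewrite exprS invfM normcM exprS.
have -> : 2 * 2 ^+ q * n.+1%:R^-1 ^+ 2 = (2 * n.+1%:R^-1) * (2 ^+ q * n.+1%:R^-1) :> R.
  by ring.
by apply: ler_pM; rewrite ?normc_ge0 ?normc_offsetV_le ?normc_offsetVX_le.
Qed.

Definition inner_sum (b : bool) (p : nat) (z : C) (n : nat) : C :=
  \sum_(1 <= k < n.+1) z ^+ k / (k%:R - offset b) ^+ p.

Lemma inner_sumS b p z n :
  inner_sum b p z n.+1 = inner_sum b p z n + z ^+ n.+1 / (n.+1%:R - offset b) ^+ p.
Proof. by rewrite /inner_sum big_nat_recr. Qed.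

Lemma inner_sum0 b p z : inner_sum b p z 0 = 0.
Proof. by rewrite /inner_sum big_geq. Qed.

Lemma zetasumE p (z : C) : zetasum p z = inner_sum false p z.
Proof. by apply/funext => n; apply: eq_bigr => k _; rewrite subr0. Qed.

(** A letter (p, z) stands for the inner sum with exponent p and argument z. *)
Definition letter : Type := (nat * C)%type.

Definition is_letter (t : letter) : Prop := (0 < t.1)%N /\ is_root_of_unity t.2.

Definition convergent (t : letter) : Prop := is_letter t /\ t <> (1%N, 1).

Definition inner_prod (b : bool) (l : seq letter) (n : nat) : C :=
  \prod_(t <- l) inner_sum b t.1 t.2 n.

Definition euler_part (b : bool) (l : seq letter) (q : nat) (x : C) (N : nat) : C :=
  \sum_(1 <= n < N.+1) inner_prod b l n / (n%:R - offset b) ^+ q * x ^+ n.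

Definition euler_lim (b : bool) (l : seq letter) (q : nat) (x : C) : C :=
  limn (euler_part b l q x : nat -> R[i]^o).

Definition letters (k : nat) (p : 'I_k -> nat) (xs : 'I_k -> C) : seq letter :=
  [seq (p j, xs j) | j <- enum 'I_k].

Lemma inner_prod_letters b k (p : 'I_k -> nat) (xs : 'I_k -> C) n :
  inner_prod b (letters p xs) n = \prod_(j < k) inner_sum b (p j) (xs j) n.
Proof. by rewrite /inner_prod big_map big_enum. Qed.

Lemma euler_TE k (p : 'I_k -> nat) q (xs : 'I_k -> C) x :
  euler_T p q xs x = euler_lim true (letters p xs) q x.
Proof.
rewrite /euler_T /euler_lim /euler_part.
apply: (congr1 (fun u : nat -> R[i]^o => limn u)); apply/funext => N.
by apply: eq_bigr => n _; rewrite inner_prod_letters.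
Qed.

Lemma euler_SE k (p : 'I_k -> nat) q (xs : 'I_k -> C) x :
  euler_S p q xs x = euler_lim false (letters p xs) q x.
Proof.
rewrite /euler_S /euler_lim /euler_part.
apply: (congr1 (fun u : nat -> R[i]^o => limn u)); apply/funext => N.
apply: eq_bigr => n _; rewrite inner_prod_letters subr0.
by under [in RHS]eq_bigr do rewrite -zetasumE.
Qed.

Lemma lettersK (l : seq letter) :
  letters (fun j : 'I_(size l) => (nth (0%N, 0) l j).1)
          (fun j : 'I_(size l) => (nth (0%N, 0) l j).2) = l.
Proof.
rewrite /letters.
rewrite -[RHS](mkseq_nth (0%N, 0)) /mkseq -val_enum_ord -map_comp.
by apply: eq_map => j /=; case: nth.
Qed.

Lemma euler_lim_lt r b l q x : (size l < r)%N -> (forall t, t \in l -> is_letter t) ->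
  (0 < q)%N -> is_root_of_unity x -> (q, x) <> (1%N, 1) ->
  euler_sum_lt r (euler_lim b l q x).
Proof.
move=> lr ll q0 x1 qx.
exists (size l), (fun j => (nth (0%N, 0) l j).1), q,
  (fun j => (nth (0%N, 0) l j).2), x; split=> //.
  by split=> // j; exact/ll/mem_nth.
by rewrite euler_TE euler_SE lettersK; case: b; [left|right].
Qed.

Lemma inner_sum_step_le b p z n : (0 < p)%N -> normc z = 1 ->
  normc (inner_sum b p z n.+1 - inner_sum b p z n) <= 2 ^+ p * n.+1%:R^-1.
Proof.
move=> p0 z1; rewrite inner_sumS addrAC subrr add0r normcM normcX z1 expr1n mul1r.
exact: normc_offsetVX_le.
Qed.

Lemma inner_sum_le b p z n : (0 < p)%N -> normc z = 1 ->
  normc (inner_sum b p z n) <= 2 ^+ p * harm n.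
Proof.
move=> p0 z1; elim: n => [|n IH].
  by rewrite inner_sum0 normc0 mulr_ge0 ?harm_ge0 ?exprn_ge0.
rewrite inner_sumS harmS mulrDr; apply: le_trans (le_normcD _ _) _.
apply: lerD => //; have := inner_sum_step_le b n p0 z1.
by rewrite inner_sumS addrAC subrr add0r.
Qed.

Lemma inner_prod_growth b l : (forall t, t \in l -> is_letter t) ->
  exists2 B : R, 0 <= B & forall n,
    (0 < n)%N -> normc (inner_prod b l n) <= B * harm n ^+ size l /\
    normc (inner_prod b l n.+1 - inner_prod b l n) <= B * harm n.+1 ^+ size l * n.+1%:R^-1.
Proof.
elim: l => [_|[p z] l IH ll].
  exists 1 => // n n0; rewrite /inner_prod !big_nil expr0 subrr normc1 normc0 !mulr1.
  by rewrite mul1r invr_ge0 ler0n.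
have [|B B0 HB] := IH; first by move=> t tl; apply: ll; rewrite inE tl orbT.
have [p0 /= /root_of_unity_normc z1] : is_letter (p, z) by apply: ll; rewrite inE eqxx.
exists (2 * (2 ^+ p * B)); first by rewrite !mulr_ge0 ?exprn_ge0.
move=> n n0; have [HB1 HB2] := HB n n0.
have Hh := harm_ge0 R; have Hp : 0 <= 2 ^+ p :> R by rewrite exprn_ge0.
have HBp := mulr_ge0 Hp B0.
rewrite /inner_prod !big_cons /= -!/(inner_prod b l _); split.
  rewrite normcM exprS.
  apply: (@le_trans _ _ ((2 ^+ p * harm n) * (B * harm n ^+ size l))).
    by apply: ler_pM; rewrite ?normc_ge0 // inner_sum_le.
  have -> : 2 ^+ p * harm n * (B * harm n ^+ size l) =
    (2 ^+ p * B) * (harm n * harm n ^+ size l) by ring.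
  apply: ler_wpM2r; first by rewrite mulr_ge0 ?exprn_ge0.
  by rewrite ler_peMl // ler1n.
have -> : inner_sum b p z n.+1 * inner_prod b l n.+1 - inner_sum b p z n * inner_prod b l n =
  inner_sum b p z n.+1 * (inner_prod b l n.+1 - inner_prod b l n)
  + (inner_sum b p z n.+1 - inner_sum b p z n) * inner_prod b l n by ring.
apply: le_trans (le_normcD _ _) _; rewrite !normcM.
have -> : 2 * (2 ^+ p * B) * harm n.+1 ^+ (size l).+1 * n.+1%:R^-1 =
  (2 ^+ p * harm n.+1) * (B * harm n.+1 ^+ size l * n.+1%:R^-1)
  + (2 ^+ p * n.+1%:R^-1) * (B * (harm n.+1 * harm n.+1 ^+ size l)).
  by rewrite exprS; ring.
apply: lerD; apply: ler_pM; rewrite ?normc_ge0 ?inner_sum_le ?inner_sum_step_le //.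
apply: le_trans HB1 _; apply: ler_wpM2l => //.
apply: (@le_trans _ _ (harm n.+1 ^+ size l)).
  by rewrite lerXn2r ?nnegrE // harm_mono.
by rewrite ler_peMl ?exprn_ge0 // harm_ge1.
Qed.

Lemma tends_absolute1 (a : nat -> C) (B : R) :
  (forall N, \sum_(1 <= n < N.+1) normc (a n) <= B) ->
  exists l, tends (fun N => \sum_(1 <= n < N.+1) a n) l.
Proof.
move=> aB; have [|l al] := @tends_absolute _ (fun n => a n.+1) B.
  by move=> N; have := aB N; rewrite big_add1.
by exists l; under eq_fun do rewrite big_add1.
Qed.

(** For q > 1 the series converges absolutely; for q = 1 and x <> 1 summation by
    parts reduces to the absolutely convergent series of the increments. *)
Lemma euler_part_cvg b l q x : (forall t, t \in l -> is_letter t) ->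
  convergent (q, x) -> tends (euler_part b l q x) (euler_lim b l q x).
Proof.
move=> ll [[/= q0 xr] qx]; have x1 := root_of_unity_normc xr.
suff [v ev] : exists v, tends (euler_part b l q x) v.
  by rewrite /euler_lim (tends_lim ev).
have [B B0 HB] := inner_prod_growth b ll.
have [D D0 HD] := harm_pow_summable R (size l).
have [q2|] := ltnP 1 q.
  apply: (@tends_absolute1 _ (2 ^+ q * B * D)) => N.
  apply: le_trans (ler_wpM2l _ (HD N)); last by rewrite mulr_ge0 ?exprn_ge0.
  rewrite mulr_sumr !big_add1 /=; apply: ler_sum => n _.
  rewrite !normcM normcX x1 expr1n mulr1.
  have -> : 2 ^+ q * B * (harm n.+1 ^+ size l * n.+1%:R^-1 ^+ 2) =
    (B * harm n.+1 ^+ size l) * (2 ^+ q * n.+1%:R^-1 ^+ 2) by ring.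
  by apply: ler_pM; rewrite ?normc_ge0 ?normc_offsetVX2_le //; case: (HB n.+1).
move=> q1; have {q0 q1} q1 : q = 1%N by apply/eqP; rewrite eqn_leq q1 q0.
rewrite q1 in qx *; have {qx} x_neq1 : x - 1 != 0.
  by rewrite subr_eq0; apply/eqP => xe; apply: qx; rewrite xe.
pose f n := inner_prod b l n / (n%:R - offset b).
have step n : (0 < n)%N ->
    normc (f n.+1 - f n) <= 10 * B * (harm n.+1 ^+ size l * n.+1%:R^-1 ^+ 2).
  case: n => // n _; have [HB1 HB2] := HB n.+1 isT.
  have -> : f n.+2 - f n.+1 =
     (inner_prod b l n.+2 - inner_prod b l n.+1) / (n.+2%:R - offset b)
     - inner_prod b l n.+1 * ((n.+2%:R - offset b)^-1 * (n.+1%:R - offset b)^-1).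
    have := natr_offset_neq0 b n; have := natr_offset_neq0 b n.+1.
    rewrite /f; set v := n.+2%:R - _; set w := n.+1%:R - _.
    have -> : v = w + 1 by rewrite /v -(natr1 n.+1) addrAC.
    by move=> h1 h2; field; rewrite h1 h2.
  apply: le_trans (le_normcD _ _) _; rewrite normcN !normcM.
  have -> : 10 * B * (harm n.+2 ^+ size l * n.+2%:R^-1 ^+ 2) =
    (B * harm n.+2 ^+ size l * n.+2%:R^-1) * (2 * n.+2%:R^-1) +
    (B * harm n.+2 ^+ size l) * ((2 * n.+2%:R^-1) * (2 * (2 * n.+2%:R^-1))).
    by ring.
  have v2 m : normc (m.+1%:R - offset b)^-1 <= 2 * m.+1%:R^-1 by exact: normc_offsetV_le.
  have hm : harm n.+1 ^+ size l <= harm n.+2 ^+ size l.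
    by rewrite lerXn2r ?nnegrE ?harm_ge0 // harm_mono.
  apply: lerD; apply: ler_pM; rewrite ?normc_ge0 ?mulr_ge0 ?normc_ge0 //.
    by apply: le_trans HB1 _; apply: ler_wpM2l.
  apply: ler_pM; rewrite ?normc_ge0 //; apply: le_trans (v2 n) _.
  rewrite ler_pM2l // -[leRHS]invrK invfM invrK lef_pV2 ?posrE ?mulr_gt0 ?invr_gt0 ?ltr0n //.
  rewrite mulrC ler_pdivrMr // -natrM ler_nat; lia.
have abel N : (x - 1) * euler_part b l 1 x N =
    f N * x ^+ N.+1 - f 0 * x - \sum_(0 <= n < N) (f n.+1 - f n) * x ^+ n.+1.
  elim: N => [|N IH]; first by rewrite /euler_part !big_geq // mulr0 expr1 subrr subr0.
  rewrite /euler_part big_nat_recr // mulrDr -/(euler_part b l 1 x N) IH.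
  rewrite [in RHS]big_nat_recr //=.
  by rewrite expr1 -/(f N.+1) (exprS x N.+1); ring.
have [s ss] : exists s, tends (fun N => \sum_(0 <= n < N) (f n.+1 - f n) * x ^+ n.+1) s.
  apply: (@tends_absolute _ _ (normc (f 1%N - f 0) + 10 * B * D)) => -[|N].
    by rewrite big_geq // addr_ge0 ?normc_ge0 ?mulr_ge0.
  rewrite big_ltn // normcM expr1 x1 mulr1 lerD2l.
  apply: le_trans (ler_wpM2l _ (HD N.+1)); last by rewrite mulr_ge0.
  rewrite mulr_sumr [leRHS]big_ltn // [in leRHS]big_add1 /=.
  have : \sum_(1 <= i < N.+1) normc ((f i.+1 - f i) * x ^+ i.+1) <=
     \sum_(1 <= i < N.+1) 10 * B * (harm i.+1 ^+ size l * i.+1%:R^-1 ^+ 2).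
    rewrite !big_add1 /=; apply: ler_sum => n _.
    by rewrite normcM normcX x1 expr1n mulr1 step.
  move=> h; apply: le_trans h _; rewrite lerDr !mulr_ge0 ?exprn_ge0 ?harm_ge0 ?invr_ge0 //.
have f0 : tends (fun N => f N * x ^+ N.+1) 0.
  apply: (@tends_eventually _ (fun N => if N is 0 then 0 else f N * x ^+ N.+1) _ _ 1).
    by case.
  have [D1 D10 HD1] := harm_pow_le R (size l).
  apply: (@tends_squeeze _ _ _ (fun N => 4 * B * (harm N ^+ size l * N.+1%:R^-1))); last first.
    exact: harm_pow_over_cvg0.
  case=> [|n].
    by rewrite subrr normc0 mulr_ge0 ?mulr_ge0 ?exprn_ge0 ?harm_ge0 ?invr_ge0.
  rewrite subr0 normcM normcX x1 expr1n mulr1 /f normcM.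
  have [HB1 _] := HB n.+1 isT.
  have -> : 4 * B * (harm n.+1 ^+ size l * n.+2%:R^-1) =
    (B * harm n.+1 ^+ size l) * (2 * (2 * n.+2%:R^-1)) by ring.
  apply: ler_pM; rewrite ?normc_ge0 //; apply: le_trans (normc_offsetV_le b n) _.
  rewrite ler_pM2l // -[leRHS]invrK invfM invrK lef_pV2 ?posrE ?mulr_gt0 ?invr_gt0 ?ltr0n //.
  rewrite mulrC ler_pdivrMr // -natrM ler_nat; lia.
exists ((x - 1)^-1 * (0 - f 0 * x - s)).
have -> : euler_part b l 1 x = fun N => (x - 1)^-1 *
   (f N * x ^+ N.+1 - f 0 * x - \sum_(0 <= n < N) (f n.+1 - f n) * x ^+ n.+1).
  by apply/funext => N; rewrite -abel mulKf.
apply: tendsZ; apply: tendsB; last exact: ss.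
by apply: tendsB; [exact: f0 | exact: tends_cst].
Qed.

Lemma inner_sum_euler_part b p z : inner_sum b p z = euler_part b [::] p z.
Proof.
apply/funext => N; apply: eq_bigr => n _.
by rewrite /inner_prod big_nil mul1r mulrC.
Qed.

(** The tails of a convergent inner sum are O(1/n): by comparison with a
    telescoping series if p > 1, by summation by parts if p = 1. *)
Lemma inner_sum_tail b p z : convergent (p, z) ->
  exists2 B : R, 0 <= B & forall n m, (n <= m)%N ->
    normc (inner_sum b p z m - inner_sum b p z n) <= B * n.+1%:R^-1.
Proof.
move=> [[/= p0 zr] pz]; have z1 := root_of_unity_normc zr.
have [p2|] := ltnP 1 p.
  exists (2 ^+ p * 2); first by rewrite mulr_ge0 ?exprn_ge0.
  move=> n m /subnK <-.
  apply: (@le_trans _ _ (2 ^+ p * 2 * (n.+1%:R^-1 - (m - n + n).+1%:R^-1))); last first.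
    by rewrite ler_wpM2l ?mulr_ge0 ?exprn_ge0 // lerBlDr lerDl invr_ge0 ler0n.
  elim: (m - n)%N => [|d IH]; first by rewrite add0n !subrr normc0 mulr0.
  rewrite addSn inner_sumS addrAC; apply: le_trans (le_normcD _ _) _.
  have -> : 2 ^+ p * 2 * (n.+1%:R^-1 - (d + n).+2%:R^-1) =
     2 ^+ p * 2 * (n.+1%:R^-1 - (d + n).+1%:R^-1) +
     2 ^+ p * (2 * ((d + n).+1%:R^-1 - (d + n).+2%:R^-1)) :> R by ring.
  apply: lerD => //; rewrite normcM normcX z1 expr1n mul1r.
  apply: le_trans (normc_offsetVX2_le _ _ p2) _.
  by rewrite ler_wpM2l ?exprn_ge0 // invn_gap.
move=> p1; have {p0 p1} p1 : p = 1%N by apply/eqP; rewrite eqn_leq p1 p0.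
rewrite p1 in pz *; have {pz} z_neq1 : z - 1 != 0.
  by rewrite subr_eq0; apply/eqP => ze; apply: pz; rewrite ze.
have zn0 : 0 < normc (z - 1).
  rewrite lt_def normc_ge0 andbT; apply: contra z_neq1 => /eqP/eq0_normc ->.
  by [].
exists (4 / normc (z - 1)); first by rewrite divr_ge0 ?normc_ge0.
pose f n : R := (n.+1%:R - offsetR b)^-1.
have fn n : normc (n.+1%:R - offset b)^-1 = f n by rewrite normc_offsetV.
have fdec n : f n.+1 <= f n.
  by rewrite lef_pV2 ?posrE ?natr_offsetR_gt0 // lerD2r ler_nat.
have f_ge0 n : 0 <= f n by rewrite invr_ge0 ltW ?natr_offsetR_gt0.
have fC n : (n.+1%:R - offset b)^-1 = (f n)%:C%C by rewrite natr_offset fmorphV.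
move=> n m /subnK <-.
suff : normc ((z - 1) * (inner_sum b 1 z (m - n + n) - inner_sum b 1 z n)
   - (f (m - n + n)%N)%:C%C * z ^+ (m - n + n).+1) <= 2 * f n - f (m - n + n)%N.
  set S := inner_sum _ _ _ _ - _; set u := _ * z ^+ _ => h.
  rewrite mulrAC ler_pdivlMr // mulrC -normcM.
  have -> : (z - 1) * S = ((z - 1) * S - u) + u by rewrite subrK.
  apply: le_trans (le_normcD _ _) _.
  have -> : normc u = f (m - n + n)%N.
    by rewrite /u normcM normcX z1 expr1n mulr1 normc_real ger0_norm.
  have := normc_offsetV_le b n; rewrite fn.
  by move: h; set w := normc _; set t := n.+1%:R^-1; lra.
elim: (m - n)%N => [|d IH].
  rewrite add0n subrr mulr0 sub0r normcN normcM normcX z1 expr1n mulr1.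
  by rewrite normc_real ger0_norm // mulr2n mulrDl mul1r addrK.
rewrite addSn inner_sumS expr1 fC.
set S := inner_sum b 1 z (d + n) in IH *.
have -> : (z - 1) * (S + z ^+ (d + n).+1 * (f (d + n)%N)%:C%C - inner_sum b 1 z n) -
   (f (d + n).+1)%:C%C * z ^+ (d + n).+2 =
   ((z - 1) * (S - inner_sum b 1 z n) - (f (d + n)%N)%:C%C * z ^+ (d + n).+1)
   + (f (d + n)%N - f (d + n).+1)%:C%C * z ^+ (d + n).+2.
  by rewrite rmorphB (exprS z (d + n).+1) /=; ring.
apply: le_trans (le_normcD _ _) _.
have -> : 2 * f n - f (d + n).+1 =
  (2 * f n - f (d + n)%N) + (f (d + n)%N - f (d + n).+1) by ring.
apply: lerD => //.
by rewrite normcM normcX z1 expr1n mulr1 normc_real ger0_norm // subr_ge0.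
Qed.

Lemma inner_sum_fast b p z : convergent (p, z) ->
  exists2 B : R, 0 <= B & forall n,
    normc (inner_sum b p z n - euler_lim b [::] p z) <= B * n.+1%:R^-1.
Proof.
move=> pz; have [B B0 HB] := inner_sum_tail b pz; exists B => // n.
rewrite normcB; apply: (@tends_norm_le _ (inner_sum b p z) _ _ _ n); last by move=> m /HB.
by rewrite inner_sum_euler_part; exact: euler_part_cvg.
Qed.

Lemma inner_sum_cvg b p z : convergent (p, z) ->
  tends (inner_sum b p z) (euler_lim b [::] p z).
Proof. by move=> pz; rewrite inner_sum_euler_part; exact: euler_part_cvg. Qed.

End ShiftedSums.

(** * Spans of products, and limits of sums with few inner sums *)

Section Spans.
Variables (R : realType) (K : set R[i]) (r : nat).
Local Notation C := R[i].
Local Notation harm := (harm R).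
Hypothesis K_div : divring_closed (mem K).

Lemma subfield1 : K 1.
Proof. by case: K_div => /set_mem. Qed.

Lemma subfieldB a b : K a -> K b -> K (a - b).
Proof. by case: K_div => _ Ks _ Ka Kb; apply/set_mem/Ks; exact/mem_set. Qed.

Lemma subfield_div a b : K a -> K b -> K (a / b).
Proof. by case: K_div => _ _ Kd Ka Kb; apply/set_mem/Kd; exact/mem_set. Qed.

Lemma subfield0 : K 0. Proof. by rewrite -(subrr 1); apply: subfieldB; exact: subfield1. Qed.

Lemma subfieldN a : K a -> K (- a).
Proof. by rewrite -sub0r => Ka; apply: subfieldB => //; exact: subfield0. Qed.

Lemma subfieldD a b : K a -> K b -> K (a + b).
Proof. by rewrite -[b in a + b]opprK => Ka /subfieldN Kb; exact: subfieldB. Qed.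

Lemma subfieldV a : K a -> K a^-1.
Proof. by rewrite -div1r; apply: subfield_div; exact: subfield1. Qed.

Lemma subfieldM a b : K a -> K b -> K (a * b).
Proof. by rewrite -[b in a * b]invrK => Ka /subfieldV Kb; exact: subfield_div. Qed.

Lemma subfieldX a n : K a -> K (a ^+ n).
Proof.
move=> Ka; elim: n => [|n IH]; first exact: subfield1.
by rewrite exprS; exact: subfieldM.
Qed.

Lemma subfield_sign n : K ((-1) ^+ n).
Proof. by apply: subfieldX; apply: subfieldN; exact: subfield1. Qed.

Lemma subfield_int (z : int) : K z%:~R.
Proof.
have Kn (n : nat) : K n%:R.
  elim: n => [|n IH]; first exact: subfield0.
  by rewrite -natr1; apply: subfieldD => //; exact: subfield1.
by case: z => n; rewrite ?NegzE ?rmorphN; [exact: Kn | apply: subfieldN; exact: Kn].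
Qed.

Lemma subfield_prod (I : Type) (s : seq I) (F : I -> C) :
  (forall i, K (F i)) -> K (\prod_(i <- s) F i).
Proof. by move=> KF; elim/big_ind: _ => // [|a b]; [exact: subfield1|exact: subfieldM]. Qed.

(** With the flag set, the K-linear combinations of nonempty products of Euler
    sums of order less than r; without it, also the constants, that is the
    K-algebra generated by these sums. *)
Inductive prodspan (proper : bool) : C -> Prop :=
| prodspan0 : prodspan proper 0
| prodspan_monomial c f : K c -> (proper -> f <> [::]) ->
    (forall v, v \in f -> euler_sum_lt r v) ->
    prodspan proper (c * \prod_(v <- f) v)
| prodspanD u v : prodspan proper u -> prodspan proper v -> prodspan proper (u + v).

Lemma prodspan_weak b v : prodspan b v -> prodspan false v.
Proof.
elim=> [|c f Kc _ fr|u w _ su _ sw]; first exact: prodspan0.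
- exact: prodspan_monomial.
- exact: prodspanD.
Qed.

Lemma prodspanK c : K c -> prodspan false c.
Proof.
move=> Kc; have -> : c = c * \prod_(v <- [::]) v by rewrite big_nil mulr1.
exact: prodspan_monomial.
Qed.

Lemma prodspan_gen v : euler_sum_lt r v -> prodspan true v.
Proof.
move=> vr; have -> : v = 1 * \prod_(w <- [:: v]) w by rewrite big_seq1 mul1r.
by apply: prodspan_monomial => //; [exact: subfield1 | move=> w; rewrite inE => /eqP ->].
Qed.

Lemma prodspanM b1 b2 u v : prodspan b1 u -> prodspan b2 v -> prodspan (b1 || b2) (u * v).
Proof.
move=> su; elim: su v => [v _|c f Kc fn fr v|u1 u2 _ IH1 _ IH2 v sv].
- by rewrite mul0r; exact: prodspan0.
- elim=> [|c' f' Kc' fn' fr'|v1 v2 _ IH1 _ IH2].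
  + by rewrite mulr0; exact: prodspan0.
  + rewrite mulrACA -big_cat; apply: prodspan_monomial; first exact: subfieldM.
      move=> /orP[/fn|/fn']; first by case: f {fr fn}.
      by case: f' {fr' fn'} => // a f' _; case: f {fr fn}.
    by move=> w; rewrite mem_cat => /orP[/fr|/fr'].
  + by rewrite mulrDr; exact: prodspanD.
- by rewrite mulrDl; apply: prodspanD; [exact: IH1|exact: IH2].
Qed.

Lemma prodspanZ b c v : K c -> prodspan b v -> prodspan b (c * v).
Proof. by move=> /prodspanK sc sv; exact: (prodspanM sc sv). Qed.

Lemma prodspanN b v : prodspan b v -> prodspan b (- v).
Proof. by rewrite -mulN1r; apply: prodspanZ; apply: subfieldN; exact: subfield1. Qed.

Lemma prodspanB b u v : prodspan b u -> prodspan b v -> prodspan b (u - v).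
Proof. by move=> su /prodspanN; exact: prodspanD. Qed.

Lemma prodspan_sum b (I : Type) (s : seq I) (P : pred I) (F : I -> C) :
  (forall i, P i -> prodspan b (F i)) -> prodspan b (\sum_(i <- s | P i) F i).
Proof. by move=> sF; elim/big_ind: _ => //; [exact: prodspan0|exact: prodspanD]. Qed.

Lemma prodspan_eqmod a b : prodspan true (a - b) -> eqmod_products K r a b.
Proof.
suff h v : prodspan true v -> exists L : seq (C * seq C),
    (forall t, t \in L -> [/\ K t.1, t.2 <> [::] &
       forall w, w \in t.2 -> euler_sum_lt r w]) /\
    v = \sum_(t <- L) t.1 * \prod_(w <- t.2) w.
  move=> /h[L [Lok ab]].
  exists (size L), (fun i => (tnth (in_tuple L) i).1),
    (fun i => (tnth (in_tuple L) i).2); split.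
  - by move=> i; case: (Lok _ (mem_tnth i (in_tuple L))).
  - by move=> i; case: (Lok _ (mem_tnth i (in_tuple L))).
  - by rewrite ab big_tnth.
elim=> [|c f Kc fn fr|u w _ [L1 [L1ok ->]] _ [L2 [L2ok ->]]].
- by exists [::]; rewrite big_nil.
- exists [:: (c, f)]; split; last by rewrite big_seq1.
  by move=> t; rewrite inE => /eqP -> /=; split=> //; exact: fn.
- exists (L1 ++ L2); split; last by rewrite big_cat.
  by move=> t; rewrite mem_cat => /orP[/L1ok|/L2ok].
Qed.

Lemma euler_lim_span b l q x : (size l < r)%N -> (forall t, t \in l -> is_letter t) ->
  convergent (q, x) -> prodspan true (euler_lim b l q x).
Proof. by move=> lr ll [[/= q0 x1] qx]; apply/prodspan_gen/euler_lim_lt. Qed.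

(** The rate 1/(M - n), which gets worse as n approaches the truncation bound M,
    is what a convergent inner sum of length M - n provides. *)
Definition fast (U : nat -> nat -> C) (lam : C) : Prop :=
  exists2 B : R, 0 <= B & forall M n, (n <= M)%N ->
    normc (U M n - lam) <= B * (M - n).+1%:R^-1.

Lemma fast_cst c : fast (fun _ _ => c) c.
Proof. by exists 0 => // M n _; rewrite subrr normc0 mul0r. Qed.

Lemma fastM U V a b : fast U a -> fast V b ->
  fast (fun M n => U M n * V M n) (a * b).
Proof.
move=> [A A0 HA] [B B0 HB].
exists (A * (normc b + B) + normc a * B).
  by rewrite addr_ge0 ?mulr_ge0 ?addr_ge0 ?normc_ge0.
move=> M n nM; set t := _^-1.
have t0 : 0 <= t by rewrite invr_ge0 ler0n.
have t1 : t <= 1 by rewrite invf_le1 ?ler1n ?ltr0n.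
have -> : U M n * V M n - a * b = (U M n - a) * V M n + a * (V M n - b) by ring.
apply: le_trans (le_normcD _ _) _; rewrite !normcM.
have -> : (A * (normc b + B) + normc a * B) * t =
  A * (normc b + B) * t + normc a * (B * t) by ring.
apply: lerD; last by apply: ler_wpM2l (HB _ _ nM); rewrite normc_ge0.
have -> : A * (normc b + B) * t = A * t * (normc b + B) by ring.
apply: ler_pM; rewrite ?normc_ge0 ?HA //.
have -> : V M n = b + (V M n - b) by ring.
apply: le_trans (le_normcD _ _) _; rewrite lerD2l.
by apply: le_trans (HB _ _ nM) _; rewrite ler_piMr.
Qed.

Lemma fast_inner_sum b p z (phi : nat -> nat -> nat) : convergent (p, z) ->
  (forall M n, (n <= M)%N -> (M - n <= phi M n)%N) ->
  fast (fun M n => inner_sum b p z (phi M n)) (euler_lim b [::] p z).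
Proof.
move=> pz phiP; have [B B0 HB] := inner_sum_fast b pz; exists B => // M n nM.
apply: le_trans (HB _) _; rewrite ler_wpM2l // lef_pV2 ?posrE ?ltr0n //.
by rewrite ler_nat ltnS phiP.
Qed.

(** The space spanned by the monomials with fewer than d inner sums of length n;
    all other dependence on M and n is in a power and in a factor with a fast
    limit.  By filt_ext only the values for 0 < n <= M matter.  The condition on
    e and v makes sure that multiplying the terms of a convergent series by
    v^n / n^e cannot destroy convergence. *)
Inductive filt (b : bool) (d : nat) : (nat -> nat -> C) -> Prop :=
| filt0 : filt b d (fun _ _ => 0)
| filt_monomial v e l U lam : is_root_of_unity v -> (e = 0%N -> v = 1) ->
    (forall t, t \in l -> is_letter t) -> (size l < d)%N ->
    fast U lam -> prodspan false lam ->
    filt b d (fun M n => v ^+ n / (n%:R - offset R b) ^+ e * inner_prod b l n * U M n)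
| filtD f g : filt b d f -> filt b d g -> filt b d (fun M n => f M n + g M n)
| filt_ext f g : filt b d f ->
    (forall M n, (0 < n)%N -> (n <= M)%N -> f M n = g M n) -> filt b d g.

Lemma filt_le b d d' f : (d <= d')%N -> filt b d f -> filt b d' f.
Proof.
move=> dd; elim=> [|v e l U lam v1 e0 ll ld Ul sl|f1 f2 _ IH1 _ IH2|f1 f2 _ IH1 ff].
- exact: filt0.
- by apply: (@filt_monomial _ _ _ _ _ _ lam) => //; exact: leq_trans dd.
- exact: filtD.
- exact: filt_ext IH1 ff.
Qed.

Lemma filtM b d d' f g : filt b d.+1 f -> filt b d' g ->
  filt b (d + d') (fun M n => f M n * g M n).
Proof.
move=> ff; elim: ff g => [g _|v e l U lam v1 e0 ll ld Ul sl g|f1 f2 _ IH1 _ IH2 g fg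
    |f1 f2 _ IH1 ff g fg].
- by apply: filt_ext (filt0 _ _) _ => M n _ _; rewrite mul0r.
- elim=> [|v' e' l' U' lam' v1' e0' ll' ld' Ul' sl'|g1 g2 _ IH1 _ IH2|g1 g2 _ IH1 gg].
  + by apply: filt_ext (filt0 _ _) _ => M n _ _; rewrite mulr0.
  + apply: (@filt_ext _ _ (fun M n => (v * v') ^+ n / (n%:R - offset R b) ^+ (e + e')
       * inner_prod b (l ++ l') n * (U M n * U' M n))).
      apply: (@filt_monomial _ _ _ _ _ _ (lam * lam')).
      * exact: root_of_unityM.
      * by move=> /eqP; rewrite addn_eq0 => /andP[/eqP/e0 -> /eqP/e0' ->]; rewrite mulr1.
      * by move=> t; rewrite mem_cat => /orP[/ll|/ll'].
      * by rewrite size_cat -addnS leq_add.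
      * exact: fastM.
      * exact: (prodspanM sl sl').
    by move=> M n _ _; rewrite /inner_prod big_cat exprMn exprD invfM /=; ring.
  + by apply: filt_ext (filtD IH1 IH2) _ => M n _ _; rewrite mulrDr.
  + by apply: filt_ext IH1 _ => M n n0 nM; rewrite gg.
- by apply: filt_ext (filtD (IH1 _ fg) (IH2 _ fg)) _ => M n _ _; rewrite mulrDl.
- by apply: filt_ext (IH1 _ fg) _ => M n n0 nM; rewrite ff.
Qed.

Lemma filt_cst b c : prodspan false c -> filt b 1 (fun _ _ => c).
Proof.
move=> sc; apply: (@filt_ext _ _ (fun M n => 1 ^+ n / (n%:R - offset R b) ^+ 0
  * inner_prod b [::] n * c)).
  by apply: (@filt_monomial _ _ _ _ _ _ c) => //; [exact: root_of_unity1|exact: fast_cst].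
by move=> M n _ _; rewrite /inner_prod big_nil expr1n expr0 invr1 !mul1r.
Qed.

Lemma filtZ b d c f : prodspan false c -> filt b d f -> filt b d (fun M n => c * f M n).
Proof. by move=> sc; exact: (filtM (filt_cst b sc)). Qed.

Lemma filt_sum b d (I : Type) (s : seq I) (F : I -> nat -> nat -> C) :
  (forall i, filt b d (F i)) -> filt b d (fun M n => \sum_(i <- s) F i M n).
Proof.
move=> fF; elim: s => [|i s IH].
  by apply: filt_ext (filt0 _ _) _ => M n _ _; rewrite big_nil.
by apply: filt_ext (filtD (fF i) IH) _ => M n _ _; rewrite big_cons.
Qed.

Lemma filt_fast b U lam : fast U lam -> prodspan false lam -> filt b 1 U.
Proof.
move=> Ul sl; apply: (@filt_ext _ _ (fun M n => 1 ^+ n / (n%:R - offset R b) ^+ 0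
  * inner_prod b [::] n * U M n)).
  by apply: (@filt_monomial _ _ _ _ _ _ lam) => //; exact: root_of_unity1.
by move=> M n _ _; rewrite /inner_prod big_nil expr1n expr0 invr1 !mul1r.
Qed.

Lemma filt_letter b p z : is_letter (p, z) -> filt b 2 (fun _ n => inner_sum b p z n).
Proof.
move=> pz; apply: (@filt_ext _ _ (fun M n => 1 ^+ n / (n%:R - offset R b) ^+ 0
  * inner_prod b [:: (p, z)] n * 1)).
  apply: (@filt_monomial _ _ _ _ _ _ 1) => //; first exact: root_of_unity1.
  - by move=> t; rewrite inE => /eqP ->.
  - exact: fast_cst.
  - by apply: prodspanK; exact: subfield1.
by move=> M n _ _; rewrite /inner_prod big_seq1 expr1n expr0 invr1 !mul1r mulr1.
Qed.

Lemma filt_power b e v : is_letter (e, v) ->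
  filt b 1 (fun _ n => v ^+ n / (n%:R - offset R b) ^+ e).
Proof.
move=> [/= e0 v1]; apply: (@filt_ext _ _ (fun M n => v ^+ n / (n%:R - offset R b) ^+ e
  * inner_prod b [::] n * 1)).
  apply: (@filt_monomial _ _ _ _ _ _ 1) => //; first by move=> e0'; rewrite e0' in e0.
    exact: fast_cst.
  by apply: prodspanK; exact: subfield1.
by move=> M n _ _; rewrite /inner_prod big_nil !mulr1.
Qed.

(** Every term of the expanded product, except for the product of all u's, has a
    factor w in place of an inner sum. *)
Lemma filt_prod_lead b (I : Type) (s : seq I) (u w : I -> nat -> nat -> C) :
  (forall i, filt b 2 (u i)) -> (forall i, filt b 1 (w i)) ->
  filt b (size s) (fun M n => \prod_(i <- s) (u i M n + w i M n)
                              - \prod_(i <- s) u i M n).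
Proof.
move=> fu fw.
have fpu (t : seq I) : filt b (size t).+1 (fun M n => \prod_(i <- t) u i M n).
  elim: t => [|i t IH].
    apply: filt_ext (filt_cst b (prodspanK subfield1)) _ => M n _ _; by rewrite big_nil.
  by apply: filt_ext (filtM (fu i) IH) _ => M n _ _; rewrite big_cons.
elim: s => [|i s IH].
  by apply: filt_ext (filt0 _ _) _ => M n _ _; rewrite !big_nil subrr.
have f1 := filtM (filtD (fu i) (filt_le (leqnSn 1) (fw i))) IH.
have f2 := filtM (fw i) (fpu s).
by apply: filt_ext (filtD f1 f2) _ => M n _ _; rewrite !big_cons; ring.
Qed.

(** For a monomial, replacing the factor U by its limit costs at most the discrete
    convolution of (log n)^k / n with 1/n, which tends to 0; what is left is the
    limit of U times the partial sum of an Euler sum of order less than r. *)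
Lemma filt_limit b d f q x : filt b d f -> (d <= r)%N -> convergent (q, x) ->
  exists2 v, prodspan true v &
    tends (fun M => \sum_(1 <= n < M.+1) x ^+ n / (n%:R - offset R b) ^+ q * f M n) v.
Proof.
move=> ff dr qx.
elim: ff => [|v e l U lam v1 e0 ll ld Ul sl|f1 f2 _ [v1 s1 t1] _ [v2 s2 t2]
    |f1 f2 _ [v1 s1 t1] ff].
- exists 0; first exact: prodspan0.
  by under eq_fun do under eq_bigr do rewrite mulr0; under eq_fun do rewrite big1_eq;
     exact: tends_cst.
- have [[/= q0 x1] qx1] := qx.
  have cqx : convergent ((q + e)%N, x * v).
    split; first by split; [rewrite addn_gt0 q0|exact: root_of_unityM].
    case: (posnP e) e0 => [-> /(_ erefl) ->|e0 _]; first by rewrite addn0 mulr1.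
    by case=> /eqP; rewrite (_ : (q + e == 1)%N = false) //; lia.
  exists (lam * euler_lim b l (q + e) (x * v)).
    by apply: (prodspanM sl (euler_lim_span _ _ _ cqx)) => //; exact: leq_trans dr.
  have lim1 := tendsZ (c := lam) (euler_part_cvg (b := b) ll cqx).
  rewrite -[X in tends _ X]add0r.
  have -> : (fun M => \sum_(1 <= n < M.+1) x ^+ n / (n%:R - offset R b) ^+ q *
      (v ^+ n / (n%:R - offset R b) ^+ e * inner_prod b l n * U M n)) =
    (fun M => (\sum_(1 <= n < M.+1) inner_prod b l n / (n%:R - offset R b) ^+ (q + e)
       * (x * v) ^+ n * (U M n - lam)) + lam * euler_part b l (q + e) (x * v) M).
    apply/funext => M; rewrite /euler_part mulr_sumr -big_split /=.
    by apply: eq_bigr => n _; rewrite exprMn exprD invfM; ring.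
  apply: tendsD lim1.
  have [B B0 HB] := inner_prod_growth b ll; have [D D0 HD] := Ul.
  have xv1 := root_of_unity_normc (root_of_unityM x1 v1).
  apply: (@tends_squeeze _ _ _ (fun M => 2 ^+ (q + e) * B * D * 2 *
     (harm M ^+ (size l).+1 * M.+1%:R^-1))); last exact: harm_pow_over_cvg0.
  move=> M; rewrite subr0; apply: le_trans (normc_sum _ _ _) _.
  have -> : 2 ^+ (q + e) * B * D * 2 * (harm M ^+ (size l).+1 * M.+1%:R^-1) =
    2 ^+ (q + e) * B * D * harm M ^+ size l * (2 * harm M * M.+1%:R^-1).
    by rewrite exprS; ring.
  rewrite -sum_inv_conv mulr_sumr; apply: ler_sum_nat => n /andP[n1 nM].
  rewrite !normcM normcX xv1 expr1n mulr1.
  have -> : 2 ^+ (q + e) * B * D * harm M ^+ size l * (n%:R^-1 * (M - n).+1%:R^-1) =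
    (B * harm M ^+ size l) * (2 ^+ (q + e) * n%:R^-1) * (D * (M - n).+1%:R^-1) by ring.
  apply: ler_pM; rewrite ?mulr_ge0 ?normc_ge0 ?HD //.
  apply: ler_pM; rewrite ?mulr_ge0 ?normc_ge0 //.
    have [HB1 _] := HB n n1; apply: le_trans HB1 _; apply: ler_wpM2l => //.
    by rewrite lerXn2r ?nnegrE ?harm_ge0 // harm_mono.
  by case: n n1 {nM} => // n _; rewrite normc_offsetVX_le // addn_gt0 q0.
- exists (v1 + v2); first exact: prodspanD.
  have -> : (fun M => \sum_(1 <= n < M.+1) x ^+ n / (n%:R - offset R b) ^+ q *
      (f1 M n + f2 M n)) = fun M =>
    \sum_(1 <= n < M.+1) x ^+ n / (n%:R - offset R b) ^+ q * f1 M n +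
    \sum_(1 <= n < M.+1) x ^+ n / (n%:R - offset R b) ^+ q * f2 M n.
    apply/funext => M; rewrite -big_split /=; apply: eq_bigr => n _.
    exact: mulrDr.
  exact: tendsD t1 t2.
- exists v1; first exact: s1.
  suff -> : (fun M => \sum_(1 <= n < M.+1) x ^+ n /
     (n%:R - offset R b) ^+ q * f2 M n) = (fun M => \sum_(1 <= n < M.+1) x ^+ n /
     (n%:R - offset R b) ^+ q * f1 M n) by [].
  apply/funext => M; apply: eq_big_nat => n /andP[n1 nM].
  by rewrite ff.
Qed.

(** Laurent expansions are handled coefficientwise; they only produce zeta sums,
    hence the flag false. *)
Definition pfilt (d : nat) (P : nat -> nat -> {poly C}) : Prop :=
  forall k, filt false d (fun M n => (P M n)`_k).

Lemma pfiltM d d' P Q : pfilt d.+1 P -> pfilt d' Q ->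
  pfilt (d + d') (fun M n => P M n * Q M n).
Proof.
move=> fP fQ k.
apply: (@filt_ext _ _ (fun M n => \sum_(i < k.+1) (P M n)`_i * (Q M n)`_(k - i))).
  by apply: filt_sum => i; exact: filtM.
by move=> M n _ _; rewrite coefM.
Qed.

Lemma pfiltD d P Q : pfilt d P -> pfilt d Q -> pfilt d (fun M n => P M n + Q M n).
Proof.
by move=> fP fQ k; apply: filt_ext (filtD (fP k) (fQ k)) _ => M n _ _; rewrite coefD.
Qed.

Lemma pfilt_le d d' P : (d <= d')%N -> pfilt d P -> pfilt d' P.
Proof. by move=> dd fP k; exact: filt_le (fP k). Qed.

Lemma pfilt_cst (P : {poly C}) : (forall k, K P`_k) -> pfilt 1 (fun _ _ => P).
Proof. by move=> KP k; apply/filt_cst/prodspanK. Qed.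

(** The part B, with one inner sum from each factor, only occurs from the top power
    of 'X on: in every other term some factor contributes its constant term 1. *)
Lemma pfilt_prod (I : Type) (s : seq I) (p : I -> nat) (G : I -> nat -> nat -> {poly C}) :
  (forall i, pfilt 2 (G i)) ->
  exists A B, [/\ pfilt (size s) A, pfilt (size s).+1 B & forall M n,
    \prod_(i <- s) (1 + 'X^(p i) * G i M n) = A M n + 'X^(\sum_(i <- s) p i) * B M n].
Proof.
move=> fG; elim: s => [|i s [A [B [fA fB AB]]]].
  exists (fun _ _ => 0), (fun _ _ => 1); split.
  - by move=> k; apply: filt_ext (filt0 _ _) _ => M n _ _; rewrite coef0.
  - by apply: pfilt_cst => k; rewrite coef1; exact: (subfield_int (k == 0%N)).
  - by move=> M n; rewrite !big_nil expr0 mul1r add0r.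
have KXn m : pfilt 1 (fun _ _ => 'X^m).
  by apply: pfilt_cst => k; rewrite coefXn; exact: (subfield_int (k == m)).
have f1 : pfilt 1 (fun _ _ => 1).
  by apply: pfilt_cst => k; rewrite coef1; exact: (subfield_int (k == 0%N)).
have fF := pfiltD (pfilt_le (leqnSn 1) f1) (pfiltM (KXn (p i)) (fG i)).
exists (fun M n => (1 + 'X^(p i) * G i M n) * A M n + 'X^(\sum_(j <- s) p j) * B M n),
  (fun M n => G i M n * B M n); split.
- exact: pfiltD (pfiltM fF fA) (pfiltM (KXn _) fB).
- exact: pfiltM (fG i) fB.
- by move=> M n; rewrite !big_cons AB exprD; ring.
Qed.

Definition prodspan_cvg (u : nat -> C) : Prop := exists2 v, prodspan false v & tends u v.

Lemma prodspan_cvgD u v : prodspan_cvg u -> prodspan_cvg v ->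
  prodspan_cvg (fun n => u n + v n).
Proof. by move=> [a sa ua] [b sb vb]; exists (a + b); [exact: prodspanD|exact: tendsD]. Qed.

Lemma prodspan_cvgM u v : prodspan_cvg u -> prodspan_cvg v ->
  prodspan_cvg (fun n => u n * v n).
Proof.
move=> [a sa ua] [b sb vb]; exists (a * b); last exact: tendsM.
exact: (prodspanM sa sb).
Qed.

Lemma prodspan_cvg_cst c : prodspan false c -> prodspan_cvg (fun=> c).
Proof. by exists c => //; exact: tends_cst. Qed.

Lemma prodspan_cvg_sum (I : Type) (s : seq I) (F : I -> nat -> C) :
  (forall i, prodspan_cvg (F i)) -> prodspan_cvg (fun n => \sum_(i <- s) F i n).
Proof.
move=> fF; elim: s => [|i s IH].
  by under eq_fun do rewrite big_nil; apply: prodspan_cvg_cst; exact: prodspan0.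
by under eq_fun do rewrite big_cons; exact: prodspan_cvgD.
Qed.

Lemma prodspan_cvg_coef_prod (I : Type) (s : seq I) (G : I -> nat -> {poly C}) :
  (forall i k, prodspan_cvg (fun n => (G i n)`_k)) ->
  forall k, prodspan_cvg (fun n => (\prod_(i <- s) G i n)`_k).
Proof.
move=> sG; elim: s => [|i s IH] k.
  under eq_fun do rewrite big_nil coef1.
  by apply: prodspan_cvg_cst; apply: prodspanK; exact: (subfield_int (k == 0%N)).
under eq_fun do rewrite big_cons coefM.
by apply: prodspan_cvg_sum => j; apply: prodspan_cvgM.
Qed.

End Spans.

(** * Partial fractions *)

(** The pair (p, w) stands for the sum over m of w m / (s - m)^p. *)
Definition factor_data (T : Type) : Type := (nat * (nat -> T))%type.

Section PartialFractions.
Variable F : numFieldType.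
Implicit Types (p E : nat) (a s : F).

(** The truncated geometric series: an inverse of 'X + a%:P modulo 'X^E. *)
Definition geom E a : {poly F} := \poly_(k < E) ((- 1) ^+ k * a^-1 ^+ k.+1).

Lemma geomE E a : a != 0 -> ('X + a%:P) * geom E a = 1 - (- a^-1 *: 'X) ^+ E.
Proof.
move=> a0; have -> : geom E a = \sum_(k < E) a^-1 *: (- a^-1 *: 'X) ^+ k.
  rewrite /geom poly_def; apply: eq_bigr => k _.
  by rewrite exprZn scalerA [(- a^-1) ^+ k]exprNn exprS mulrCA.
rewrite -[RHS]opprB subrX1 -mulNr opprB -scaler_sumr -scalerAr scalerAl.
congr (_ * _); rewrite scalerDr -!mul_polyC -polyCM mulVf // polyCN mulNr opprK.
by rewrite addrC.
Qed.

(** The coefficients of the powers of the truncated geometric series are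
    integers up to powers of a. *)
Fixpoint geom_coef E p k : int :=
  if p is p'.+1 then
    \sum_(j < k.+1) (if (j < E)%N then (-1) ^+ j else 0) * geom_coef E p' (k - j)%N
  else (k == 0%N)%:Z.

Lemma coef_geomX E p a k :
  (geom E a ^+ p)`_k = (geom_coef E p k)%:~R * a^-1 ^+ (p + k).
Proof.
elim: p k => [|p IH] k /=.
  by rewrite expr0 coef1; case: k => [|k] /=; rewrite ?expr0 ?mulr1 ?mul0r.
rewrite exprS coefM rmorph_sum /= mulr_suml; apply: eq_bigr => j _.
rewrite coef_poly IH rmorphM /=.
have -> : (p.+1 + k = j.+1 + (p + (k - j)))%N by have := ltn_ord j; lia.
rewrite (exprD _ j.+1); case: ifP => jE; last by rewrite !mul0r.
by rewrite rmorphXn /= rmorphN1 mulrACA.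
Qed.

Lemma geomX_inv E p a : a != 0 ->
  exists D, ('X + a%:P) ^+ p * geom E a ^+ p = 1 + 'X^E * D.
Proof.
move=> a0; rewrite -exprMn geomE //.
elim: p => [|p [D HD]]; first by exists 0; rewrite mulr0 addr0.
exists (D - (- a^-1) ^+ E *: (1 + 'X^E * D)).
by rewrite exprS HD exprZn mulrBl -scalerAl mul1r mulrBr -scalerAr addrA.
Qed.

Definition factor_val M (f : factor_data F) s : F :=
  \sum_(m < M.+1) f.2 m / (s - m%:R) ^+ f.1.

(** This is 'X ^+ p times the Laurent expansion of the factor at the pole m in the
    variable 'X = s - m; the regular part is correct up to 'X ^+ E. *)
Definition local_factor M E (f : factor_data F) (m : nat) : {poly F} :=
  (f.2 m)%:P + 'X^(f.1) *
    \sum_(l < M.+1 | l != m :> nat) f.2 l *: geom E (m%:R - l%:R) ^+ f.1.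

Definition num M (f : factor_data F) : {poly F} :=
  \sum_(m < M.+1) f.2 m *: \prod_(l < M.+1 | l != m) ('X - (l%:R)%:P) ^+ f.1.

Definition den M p : {poly F} := \prod_(l < M.+1) ('X - (l%:R)%:P) ^+ p.

Lemma natr_ord_eq M (l m : 'I_M) : (l%:R == m%:R :> F) = (l == m).
Proof. by rewrite eqr_nat. Qed.

Lemma num_part_den M p (m : 'I_M.+1) :
  (\prod_(l < M.+1 | l != m) ('X - (l%:R)%:P) ^+ p) * ('X - (m%:R)%:P) ^+ p
  = den M p.
Proof. by rewrite /den [RHS](bigD1 m) //= mulrC. Qed.

Lemma num_den M f s : (forall m : 'I_M.+1, s != m%:R) ->
  (num M f).[s] = factor_val M f s * (den M f.1).[s].
Proof.
move=> sm; rewrite /num /factor_val horner_sum mulr_suml; apply: eq_bigr => m _.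
rewrite hornerZ -(num_part_den _ m) hornerM horner_exp hornerXsubC.
by rewrite mulrA mulrAC divfK // expf_neq0 // subr_eq0.
Qed.

Lemma monic_den M p : den M p \is monic.
Proof. by apply: monic_prod => l _; apply/monic_exp/monicXsubC. Qed.

(** The numerators have smaller degree than the denominators, so that they are
    determined by their residues modulo the prime powers of the latter. *)
Lemma size_num_part M p (m : 'I_M.+1) (A : {poly F}) : (size A <= p)%N ->
  (size (A * \prod_(l < M.+1 | l != m) ('X - (l%:R)%:P) ^+ p)%R < size (den M p))%N.
Proof.
move=> Ap; rewrite -(num_part_den p m); set B := \prod_(_ < _ | _) _.
have Bm : B \is monic by apply: monic_prod => l _; apply/monic_exp/monicXsubC.
have B0 : (0 < size B)%N by rewrite size_poly_gt0 monic_neq0.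
rewrite [X in (_ < X)%N]size_Mmonic ?monic_neq0 ?monic_exp ?monicXsubC //.
rewrite size_exp_XsubC addnS /=; apply: leq_ltn_trans (size_polyMleq _ _) _.
by move: (size A) (size B) Ap B0 => a b; lia.
Qed.

Lemma size_num M (f : factor_data F) : (0 < f.1)%N -> (size (num M f) < size (den M f.1))%N.
Proof.
move=> p0; rewrite /num (leq_ltn_trans (size_sum _ _ _)) //.
have d0 : (0 < size (den M f.1))%N by rewrite size_poly_gt0 monic_neq0 // monic_den.
rewrite -(prednK d0) ltnS; apply/bigmax_leqP => m _.
rewrite -ltnS (prednK d0) -mul_polyC; apply: size_num_part.
by apply: leq_trans (size_polyC_leq1 _) p0.
Qed.

Lemma den_sum M (L : seq (factor_data F)) :
  \prod_(f <- L) den M f.1 = den M (\sum_(f <- L) f.1).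
Proof.
elim: L => [|f L IH]; first by rewrite !big_nil /den big1 // => l _; rewrite expr0.
rewrite !big_cons IH /den -big_split /=; apply: eq_bigr => l _.
by rewrite exprD.
Qed.

Lemma size_num_prod M (L : seq (factor_data F)) :
  all (fun f => 0 < f.1)%N L -> (0 < size L)%N ->
  (size (\prod_(f <- L) num M f)%R < size (den M (\sum_(f <- L) f.1)))%N.
Proof.
case: L => // f L; rewrite -den_sum; elim: L f => [|g L IH] f /= /andP[fp Lp] _.
  by rewrite !big_seq1 size_num.
rewrite !(big_cons _ _ f).
have := IH g Lp isT; have := size_num M fp.
set P := \prod_(_ <- _) _; set Q := \prod_(_ <- _) _.
have Qm : Q \is monic by apply: monic_prod => h _; exact: monic_den.
rewrite [X in _ -> _ -> (_ < X)%N]size_Mmonic ?monic_neq0 ?monic_den //.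
move=> h1 h2; apply: leq_ltn_trans (size_polyMleq _ _) _.
move: h1 h2; set a := size _; set b := size _; set c := size _; set d := size _.
lia.
Qed.

Section AtPole.
Variables (M E : nat) (m : 'I_M.+1).
Local Notation Y := ('X - (m%:R)%:P : {poly F}).

Lemma geom_shift (l : 'I_M.+1) p : l != m ->
  exists D, ('X - (l%:R)%:P) ^+ p * (geom E (m%:R - l%:R) ^+ p \Po Y) - 1 = Y ^+ E * D.
Proof.
move=> lm; have a0 : m%:R - l%:R != 0 :> F by rewrite subr_eq0 natr_ord_eq eq_sym.
have [D HD] := geomX_inv E p a0.
exists (D \Po Y); have := congr1 (fun P => P \Po Y) HD.
rewrite comp_polyD !comp_polyM comp_Xn_poly -polyC1 comp_polyC.
rewrite [('X + _) ^+ p \Po Y]rmorphXn /= comp_polyD comp_polyX comp_polyC.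
have -> : 'X - (l%:R)%:P = Y + (m%:R - l%:R)%:P by rewrite polyCB addrA subrK.
by move=> ->; rewrite addrAC subrr add0r.
Qed.

Lemma num_congr f :
  Y ^+ E %| num M f - (local_factor M E f m \Po Y) *
    \prod_(l < M.+1 | l != m) ('X - (l%:R)%:P) ^+ f.1.
Proof.
set Q := \prod_(_ < _ | _) _.
rewrite /num (bigD1 m) //= -/Q /local_factor comp_polyD comp_polyC comp_polyM.
rewrite comp_Xn_poly rmorph_sum /= mulrDl mul_polyC opprD addrACA subrr add0r.
rewrite mulr_sumr mulr_suml -sumrB.
apply: (big_ind (fun P => Y ^+ E %| P)) => [||l lm]; first exact: dvdp0.
  exact: dvdp_add.
pose Q' : {poly F} := \prod_(i < M.+1 | (i != m) && (i != l)) ('X - (i%:R)%:P) ^+ f.1.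
have QE : Q = ('X - (l%:R)%:P) ^+ f.1 * Q' by rewrite /Q (bigD1 l).
have -> : \prod_(i < M.+1 | i != l) ('X - (i%:R)%:P) ^+ f.1 = Y ^+ f.1 * Q'.
  rewrite (bigD1 m) 1?eq_sym //=; congr (_ * _); apply: eq_bigl => i.
  by rewrite andbC.
have [D HD] : exists D, ('X - (l%:R)%:P) ^+ f.1 * (geom E (m%:R - l%:R) ^+ f.1 \Po Y) - 1 =
    Y ^+ E * D by apply: geom_shift.
rewrite QE comp_polyZ -!mul_polyC; set G := _ \Po _ in HD *; set Yp := Y ^+ f.1.
set T := (_ - _) ^+ f.1 in HD *; set w := (f.2 l)%:P.
have -> : w * (Yp * Q') - Yp * (w * G) * (T * Q') = - (w * Yp * Q') * (T * G - 1).
  by ring.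
by rewrite HD dvdp_mull // dvdp_mulr.
Qed.

Lemma num_prod_congr (L : seq (factor_data F)) :
  Y ^+ E %| \prod_(f <- L) num M f - ((\prod_(f <- L) local_factor M E f m) \Po Y) *
    \prod_(l < M.+1 | l != m) ('X - (l%:R)%:P) ^+ (\sum_(f <- L) f.1).
Proof.
elim: L => [|f L IH].
  rewrite !big_nil big1 ?mulr1; last by move=> l _; rewrite expr0.
  by rewrite -polyC1 comp_polyC subrr dvdp0.
rewrite !big_cons comp_polyM.
set B := local_factor _ _ _ _ \Po _; set C := _ \Po _.
have -> : \prod_(l < M.+1 | l != m) ('X - (l%:R)%:P : {poly F}) ^+ (f.1 + \sum_(j <- L) j.1) =
   (\prod_(l < M.+1 | l != m) ('X - (l%:R)%:P) ^+ f.1) *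
   (\prod_(l < M.+1 | l != m) ('X - (l%:R)%:P) ^+ (\sum_(j <- L) j.1)).
  by rewrite -big_split /=; apply: eq_bigr => l _; rewrite exprD.
set P := \prod_(j <- L) num M j; set Q := \prod_(l < _ | _) _ ^+ f.1.
set S := \prod_(l < _ | _) _.
have -> : num M f * P - B * C * (Q * S) = (num M f - B * Q) * P + (B * Q) * (P - C * S).
  by ring.
by apply: dvdp_add; [apply/dvdp_mulr/num_congr | exact: dvdp_mull].
Qed.

End AtPole.

Lemma coprime_poles (l m : nat) E : l != m ->
  coprimep (('X - (l%:R)%:P : {poly F}) ^+ E) (('X - (m%:R)%:P) ^+ E).
Proof.
move=> lm; apply/coprimep_expl/coprimep_expr.
by rewrite coprimep_XsubC root_XsubC eqr_nat eq_sym.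
Qed.

Lemma dvdp_den M E (D : {poly F}) :
  (forall m : 'I_M.+1, ('X - (m%:R)%:P) ^+ E %| D) -> den M E %| D.
Proof.
elim: M => [|M IH] HD.
  by rewrite /den big_ord1; exact: (HD ord0).
rewrite /den big_ord_recr /= Gauss_dvdp.
  rewrite (HD ord_max) andbT; apply: IH => m; exact: (HD (widen_ord (leqnSn _) m)).
rewrite coprimep_sym.
apply: (big_ind (fun P => coprimep _ P)) => [|P Q hP hQ|l _]; first exact: coprimep1.
  by rewrite coprimepMr hP.
by apply: coprime_poles; rewrite gtn_eqF // ltn_ord.
Qed.

(** The product has no polynomial part, so it is the sum of its principal parts,
    and the principal part at m is read off the product of the Laurent expansions
    at m.  Both sides are compared after multiplication by the common denominator:
    they agree modulo each of its coprime prime powers and have smaller degree. *)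
Lemma partial_fractions M (L : seq (factor_data F)) s : (0 < size L)%N ->
  all (fun f => 0 < f.1)%N L ->
  (forall m : 'I_M.+1, s != m%:R) ->
  \prod_(f <- L) factor_val M f s =
  \sum_(m < M.+1) \sum_(i < \sum_(f <- L) f.1)
    (\prod_(f <- L) local_factor M (\sum_(f <- L) f.1) f m)`_i /
    (s - m%:R) ^+ (\sum_(f <- L) f.1 - i).
Proof.
set E := \sum_(f <- L) f.1 => L0 Lp sm.
pose A m := take_poly E (\prod_(f <- L) local_factor M E f m).
pose Q (m : 'I_M.+1) : {poly F} := \prod_(l < M.+1 | l != m) ('X - (l%:R)%:P) ^+ E.
pose T := \sum_(m < M.+1) (A m \Po ('X - (m%:R)%:P)) * Q m.
have numE : \prod_(f <- L) num M f = T.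
  apply/eqP; rewrite -subr_eq0; apply/negPn/negP => nz.
  have : den M E %| \prod_(f <- L) num M f - T.
    apply: dvdp_den => m; rewrite /T (bigD1 m) //=.
    set P := \prod_(f <- L) num M f; set S := \sum_(_ < _ | _) _.
    set B := \prod_(f <- L) local_factor M E f m.
    have -> : P - ((A m \Po ('X - (m%:R)%:P)) * Q m + S) =
      (P - (B \Po ('X - (m%:R)%:P)) * Q m) +
      (((B - A m) \Po ('X - (m%:R)%:P)) * Q m - S).
      by rewrite comp_polyB; ring.
    rewrite dvdp_add ?num_prod_congr // dvdp_sub //.
      rewrite dvdp_mulr // -{1}(poly_take_drop E B) addrAC subrr add0r.
      by rewrite comp_polyM comp_Xn_poly dvdp_mull.
    apply: (big_ind (fun P => _ %| P)) => [||l lm]; first exact: dvdp0.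
      exact: dvdp_add.
    by rewrite dvdp_mull // /Q (bigD1 m) 1?eq_sym //= dvdp_mulr.
  move=> /(dvdp_leq nz); apply/negP; rewrite -ltnNge.
  have d0 : (0 < size (den M E))%N by rewrite size_poly_gt0 monic_neq0 // monic_den.
  apply: leq_ltn_trans (size_polyD _ _) _; rewrite size_polyN gtn_max size_num_prod //=.
  rewrite (leq_ltn_trans (size_sum _ _ _)) // -(prednK d0) ltnS.
  apply/bigmax_leqP => m _; rewrite -ltnS (prednK d0); apply: size_num_part.
  by rewrite size_comp_poly2 ?size_XsubC // size_take_poly.
have den0 : (den M E).[s] != 0.
  rewrite /den horner_prod; apply/prodf_neq0 => l _.
  by rewrite horner_exp hornerXsubC expf_neq0 // subr_eq0.
apply: (mulIf den0).
have -> : (\prod_(f <- L) factor_val M f s) * (den M E).[s] =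
    (\prod_(f <- L) num M f).[s].
  rewrite -den_sum !horner_prod -big_split /=; apply: eq_bigr => f _.
  by rewrite num_den.
rewrite numE horner_sum mulr_suml; apply: eq_bigr => m _.
rewrite hornerM horner_comp hornerXsubC -(num_part_den E m) hornerM horner_exp hornerXsubC.
rewrite mulrCA mulrC -/(Q m); congr (_ * _).
rewrite (horner_coef_wide _ (size_take_poly _ _)) mulr_suml; apply: eq_bigr => i _.
have sm0 : s - m%:R != 0 by rewrite subr_eq0.
rewrite coef_take_poly ltn_ord -mulrA; congr (_ * _).
have -> : (s - m%:R) ^+ E = (s - m%:R) ^+ (E - i) * (s - m%:R) ^+ i.
  by rewrite -exprD subnK // ltnW.
by rewrite mulKf // expf_neq0.
Qed.

End PartialFractions.

(** * Symmetric summation over the integers *)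

Section BilateralSums.
Variable R : realType.
Local Notation C := R[i].
Local Notation harm := (harm R).

(** Summation over Z by symmetric partial sums -N < n <= N. *)
Definition bilateral (G : int -> C) (N : nat) : C :=
  \sum_(1 <= n < N.+1) (G n%:Z + G (1 - n%:Z)).

Lemma bilateral_shift G N :
  bilateral (fun n => G (n - 1)) N = bilateral G N + G (- N%:Z) - G N%:Z.
Proof.
rewrite /bilateral; elim: N => [|N IH]; first by rewrite !big_geq // oppr0 add0r subrr.
rewrite big_nat_recr // [in RHS]big_nat_recr //= IH.
have -> : N.+1%:Z - 1 = N%:Z by rewrite -addn1 PoszD addrK.
have -> : 1 - N.+1%:Z = - N%:Z by rewrite -addn1 PoszD opprD addrCA subrr addr0.
have -> : - N%:Z - 1 = - N.+1%:Z by rewrite -addn1 PoszD opprD.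
by ring.
Qed.

Definition pole_term (y : C) (i m : nat) (n : int) : C :=
  y ^ n / (n%:~R - 2^-1 - m%:R) ^+ i.

Lemma pole_termS y i m n : y != 0 ->
  pole_term y i m.+1 n = y * pole_term y i m (n - 1).
Proof.
move=> y0; rewrite /pole_term mulrA; congr (_ / _ ^+ _).
  by rewrite -{2}[y]expr1z -expfzDr // addrCA subrr addr0.
by rewrite -(natr1 m) rmorphB /=; ring.
Qed.

Lemma normc_exprz (y : C) (n : int) : normc y = 1 -> normc (y ^ n) = 1.
Proof.
move=> y1; case: n => n; first by rewrite -exprnP normcX y1 expr1n.
by rewrite NegzE -exprnN normcV normcX y1 expr1n invr1.
Qed.

Lemma tends_unit_over (c : nat -> C) i k : (0 < i)%N -> (forall n, normc (c n) = 1) ->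
  tends (fun N => c N / ((N + k).+1%:R - 2^-1) ^+ i) 0.
Proof.
move=> i0 c1; apply: (@tends_squeeze _ _ _ (fun N => 2 ^+ i * (harm N ^+ 0 * N.+1%:R^-1)));
  last exact: harm_pow_over_cvg0.
move=> N; rewrite subr0 normcM c1 expr0 !mul1r.
have := normc_offsetVX_le R true (N + k) i0; rewrite /= => /le_trans; apply.
rewrite ler_wpM2l ?exprn_ge0 // lef_pV2 ?posrE ?ltr0n // ler_nat ltnS.
exact: leq_addr.
Qed.

Lemma pole_term_infty y i m : (0 < i)%N -> is_root_of_unity y ->
  tends (fun N => pole_term y i m N%:Z) 0 /\ tends (fun N => pole_term y i m (- N%:Z)) 0.
Proof.
move=> i0 yr; have y1 := root_of_unity_normc yr; split.
  rewrite /tends -(cvg_shiftn m.+1 (_ : nat -> R[i]^o)) /=.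
  have -> : (fun N => pole_term y i m (N + m.+1)%N%:Z) =
      (fun N => y ^ (N + m.+1)%N%:Z / ((N + 0).+1%:R - 2^-1) ^+ i).
    apply/funext => N; rewrite /pole_term; congr (_ / _ ^+ _).
    by rewrite addn0 -pmulrn natrD -(natr1 m) -(natr1 N); ring.
  by apply: tends_unit_over => // N; exact: normc_exprz.
have -> : (fun N : nat => pole_term y i m (- N%:Z)) =
   (fun N : nat => (-1) ^- i * y ^ (- N%:Z) / ((N + m).+1%:R - 2^-1) ^+ i).
  apply/funext => N; rewrite /pole_term.
  have -> : (- N%:Z)%:~R - 2^-1 - m%:R = - ((N + m).+1%:R - 2^-1) :> C.
    rewrite rmorphN /= -pmulrn -(natr1 (N + m)) natrD.
    by field.
  by rewrite [in LHS]exprNn invfM mulrCA mulrA.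
apply: tends_unit_over => // N; rewrite normcM normc_exprz // mulr1.
by rewrite normcV normcX normcN normc1 expr1n invr1.
Qed.

(** The value of the bilateral sum of y^n / (n - 1/2)^i.  In the case y = i = 1,
    where the two halves diverge, the terms of n and 1 - n cancel. *)
Definition kappa (y : C) (i : nat) : C :=
  if (i == 1%N) && (y == 1) then 0
  else euler_lim true [::] i y + (-1) ^+ i * y * euler_lim true [::] i y^-1.

Lemma kappa_span (K : set C) r y i : divring_closed (mem K) -> (0 < r)%N -> K y ->
  is_letter (i, y) -> prodspan K r true (kappa y i).
Proof.
move=> Kd r0 Ky [/= i0 yr]; rewrite /kappa; case: ifP => [_|iy]; first exact: prodspan0.
apply: prodspanD.
  apply: euler_lim_span => //; split=> //; case=> i1 y1.
  by rewrite i1 y1 !eqxx in iy.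
apply: prodspanZ => //.
  by apply: subfieldM => //; exact: subfield_sign.
apply: euler_lim_span => //; split; first by split=> //; exact: root_of_unityV.
by case=> i1 /(congr1 (fun z => z^-1)); rewrite invrK invr1 => y1; rewrite i1 y1 !eqxx in iy.
Qed.

(** Moving the pole by one shifts the summation index, which changes a symmetric
    partial sum by two boundary terms only. *)
Lemma bilateral_pole y i m : (0 < i)%N -> is_root_of_unity y ->
  tends (bilateral (pole_term y i m)) (y ^+ m * kappa y i).
Proof.
move=> i0 yr; have y0 := root_of_unity_neq0 yr.
elim: m => [|m IH].
  rewrite expr0 mul1r.
  have -> : bilateral (pole_term y i 0) = fun N =>
      inner_sum true i y N + (-1) ^+ i * y * inner_sum true i y^-1 N.
    apply/funext => N; rewrite /bilateral /inner_sum mulr_sumr -big_split /=.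
    apply: eq_bigr => n _; rewrite /pole_term subr0 -exprnP -pmulrn; congr (_ + _).
    have -> : (1 - n%:Z)%:~R - 2^-1 - 0%:R = - (n%:R - 2^-1) :> C.
      rewrite subr0 rmorphB /= -pmulrn.
      by field.
    rewrite (exprNn (n%:R - 2^-1) i) invfM expfzDr // expr1z -exprnN exprVn.
    rewrite -[((-1) ^+ i)^-1]exprVn invrN invr1; ring.
  rewrite /kappa; case: ifP => [/andP[/eqP -> /eqP ->]|iy].
    have -> : (fun N => inner_sum true 1 1 N +
        (-1) ^+ 1 * 1 * inner_sum true 1 (1 : C)^-1 N) = fun=> 0.
      by apply/funext => N; rewrite invr1 expr1 mulr1 mulN1r subrr.
    exact: tends_cst.
  apply: tendsD.
    apply: inner_sum_cvg; split=> //; case=> i1 y1; by rewrite i1 y1 !eqxx in iy.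
  apply/tendsZ/inner_sum_cvg; split; first by split=> //; exact: root_of_unityV.
  by case=> i1 /(congr1 (fun z => z^-1)); rewrite invrK invr1 => y1; rewrite i1 y1 !eqxx in iy.
have [h1 h2] := pole_term_infty m i0 yr.
have := tendsZ (c := y) (tendsB (tendsD IH h2) h1).
rewrite addr0 subr0 exprS -mulrA.
rewrite (_ : (fun n => y * _) = bilateral (pole_term y i m.+1)) //.
apply/funext => N; rewrite -bilateral_shift /bilateral mulr_sumr.
by apply: eq_bigr => n _; rewrite mulrDr !pole_termS.
Qed.

(** With k = n - l, the sum of z^k / (k - 1/2)^p over the window n - M <= k <= n. *)
Definition window (p : nat) (z : C) (M : nat) (n : int) : C :=
  z ^ n * \sum_(l < M.+1) (z ^+ l)^-1 / (n%:~R - 2^-1 - l%:R) ^+ p.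

Lemma window_pos p (z : C) M n : z != 0 -> (0 < n)%N -> (n <= M)%N ->
  window p z M n%:Z =
  inner_sum true p z n + (-1) ^+ p * z * inner_sum true p z^-1 (M - n).+1.
Proof.
move=> z0 n0 nM; rewrite /window -(big_mkord xpredT (fun l => (z ^+ l)^-1 / (_ - l%:R) ^+ p)).
rewrite (big_cat_nat (n := n)) //=; last exact: leqW.
rewrite mulrDr; apply: (f_equal2 +%R).
  rewrite mulr_sumr /inner_sum [in RHS]big_add1 [in RHS]big_nat_rev /= add0n.
  apply: eq_big_nat => l /andP[_ ln].
  have zu : z \is a GRing.unit by rewrite unitfE.
  rewrite (subnSK ln) mulrA -exprnP -(exprB (ltnW ln) zu); congr (_ / _ ^+ _).
  by rewrite (natrB _ (ltnW ln)) -pmulrn addrAC.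
rewrite /inner_sum big_add1 /= -[X in \sum_(X <= l < _) _]add0n big_addn (subSn nM).
rewrite mulr_sumr [RHS]mulr_sumr.
apply: eq_bigr => l _.
have -> : n%:~R - 2^-1 - (l + n)%:R = - (l.+1%:R - 2^-1) :> C.
  rewrite -pmulrn natrD -(natr1 l).
  by field.
rewrite (exprNn (l.+1%:R - 2^-1)) invfM -[((-1) ^+ p)^-1]exprVn invrN invr1.
rewrite (exprD z) (invfM (z ^+ l)) -exprnP (exprVn z) (exprS z).
have zn : z ^+ n != 0 by rewrite expf_neq0.
have h0 : l.+1%:R - 2^-1 != 0 :> C by exact: (natr_offset_neq0 R true l).
by field; rewrite zn z0 !expf_neq0.
Qed.

Lemma window_far p (z : C) M n : z != 0 -> (M < n)%N ->
  window p z M n%:Z = inner_sum true p z n - inner_sum true p z (n - M.+1).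
Proof.
move=> z0 Mn; rewrite /window -(big_mkord xpredT (fun l => (z ^+ l)^-1 / (_ - l%:R) ^+ p)).
rewrite mulr_sumr.
have -> : inner_sum true p z n = inner_sum true p z (n - M.+1) +
    \sum_((n - M.+1).+1 <= k < n.+1) z ^+ k / (k%:R - offset R true) ^+ p.
  by rewrite /inner_sum -big_cat_nat //; lia.
rewrite addrAC subrr add0r.
have -> : \sum_((n - M.+1).+1 <= k < n.+1) z ^+ k / (k%:R - offset R true) ^+ p =
  \sum_(0 <= k < M.+1) z ^+ (k + (n - M)) / ((k + (n - M))%:R - offset R true) ^+ p.
  rewrite -[X in \sum_(X <= k < _) _]add0n big_addn.
  by rewrite (_ : (n - M.+1).+1 = (n - M)%N) 1?(_ : (n.+1 - (n - M) = M.+1)%N) //; lia.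
rewrite big_nat_rev /= add0n; apply: eq_big_nat => l /andP[_ lM].
rewrite subSS; have zu : z \is a GRing.unit by rewrite unitfE.
have ln : (M - l <= n)%N by lia.
rewrite mulrA -exprnP -(exprB ln zu) -pmulrn; congr (_ ^+ _ / _ ^+ _); first by lia.
have -> : n%:R = (l + (n - M))%:R + (M - l)%:R :> C by rewrite -natrD; congr _%:R; lia.
by rewrite /=; ring.
Qed.

Lemma window_neg p (z : C) M n : z != 0 ->
  window p z M (1 - n.+1%:Z) =
  (-1) ^+ p * z * (inner_sum true p z^-1 (n.+1 + M) - inner_sum true p z^-1 n).
Proof.
move=> z0; rewrite /window -(big_mkord xpredT (fun l => (z ^+ l)^-1 / (_ - l%:R) ^+ p)).
have -> : inner_sum true p z^-1 (n.+1 + M) = inner_sum true p z^-1 n +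
    \sum_(n.+1 <= k < (n.+1 + M).+1) z^-1 ^+ k / (k%:R - offset R true) ^+ p.
  by rewrite /inner_sum -big_cat_nat //; lia.
rewrite addrAC subrr add0r !mulr_sumr.
rewrite -[X in _ = \sum_(X <= k < _) _]add0n big_addn.
rewrite (_ : ((n.+1 + M).+1 - n.+1 = M.+1)%N); last by lia.
apply: eq_bigr => l _.
have -> : (1 - n.+1%:Z)%:~R - 2^-1 - l%:R = - ((l + n.+1)%:R - 2^-1) :> C.
  rewrite rmorphB /= -pmulrn natrD -(natr1 n).
  by field.
rewrite exprNn invfM exprVn exprD invfM.
rewrite -[((-1) ^+ p)^-1]exprVn invrN invr1.
by rewrite expfzDr // expr1z -exprnN /=; ring.
Qed.

End BilateralSums.

(** * The sum over the poles *)

Section LocalExpansions.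
Variable R : realType.
Local Notation C := R[i].

Lemma convergentV p (z : C) k : convergent (p, z) -> convergent ((p + k)%N, z^-1).
Proof.
move=> [[/= p0 zr] pz]; split.
  by split; [rewrite addn_gt0 p0 | exact: root_of_unityV].
case=> /eqP pk z1; apply: pz; rewrite -[z]invrK z1 invr1; congr (_, _).
by move: pk p0; lia.
Qed.

Lemma offset_false n : n%:R - offset R false = n%:R.
Proof. exact: subr0. Qed.

Definition origin_factor (q : nat) : factor_data C := (q, fun l => (l == 0%N)%:R).

Definition lattice_factor (p : nat) (z : C) : factor_data C := (p, fun l => (z ^+ l)^-1).

Lemma factor_val_origin M q (s : C) : factor_val M (origin_factor q) s = (s ^+ q)^-1.
Proof.
rewrite /factor_val big_ord_recl /= subr0 mul1r big1 ?addr0 // => l _.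
by rewrite mul0r.
Qed.

(** The factor s^-q is singular at the origin only; elsewhere its expansion starts
    in degree 0, hence the factor 'X ^+ q. *)
Lemma local_origin M E q m : (m <= M)%N ->
  local_factor M E (origin_factor q) m =
  if m == 0%N then 1 else 'X^q * geom E (m%:R : C) ^+ q.
Proof.
move=> mM; rewrite /local_factor /=; case: eqVneq => [->|m0].
  rewrite polyC1 big1 ?mulr0 ?addr0 // => l /negPf l0.
  by rewrite l0 scale0r.
rewrite polyC0 add0r; congr (_ * _).
rewrite (bigD1 ord0) 1?eq_sym //= scale1r subr0 big1 ?addr0 // => l /andP[_].
by rewrite -val_eqE /= => /negPf ->; rewrite scale0r.
Qed.

(** The other poles, seen from m: those below m give the sum up to m, those
    above m a sum up to M - m. *)
Lemma sum_other_poles (z : C) M m e : z != 0 -> (m <= M)%N ->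
  z ^+ m * \sum_(l < M.+1 | l != m :> nat) (z ^+ l)^-1 * (m%:R - l%:R)^-1 ^+ e =
  inner_sum false e z m + (-1) ^+ e * inner_sum false e z^-1 (M - m).
Proof.
move=> z0 mM; rewrite -!zetasumE /zetasum mulr_sumr.
rewrite -(big_mkord (fun l => l != m)
  (fun l => z ^+ m * ((z ^+ l)^-1 * (m%:R - l%:R)^-1 ^+ e))).
rewrite (big_cat_nat (n := m)) //=; last exact: leqW.
rewrite [X in _ + X]big_ltn_cond ?ltnS // eqxx /=; congr (_ + _).
  rewrite [RHS]big_add1 [RHS]big_nat_rev /= add0n.
  rewrite big_nat_cond [RHS]big_nat_cond; apply: eq_big => l.
    by case: (ltngtP l m); rewrite ?andbF.
  move=> /andP[/andP[_ lm] _]; rewrite (subnSK lm) mulrA.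
  have zu : z \is a GRing.unit by rewrite unitfE.
  rewrite -(exprB (ltnW lm) zu).
  by rewrite (exprVn (m%:R - l%:R)) (natrB _ (ltnW lm)).
rewrite mulr_sumr -[X in \sum_(X <= l < _ | _) _]add1n big_addn.
rewrite subSn // big_nat_cond [RHS]big_nat_cond; apply: eq_big => l.
  by case: (posnP l) => [->|l0]; rewrite ?andbF //= andbT; case: (ltngtP (l + m) m) => //; lia.
move=> /andP[/andP[l1 _] _]; rewrite natrD opprD addrCA subrr addr0.
rewrite (exprD z) (invfM (z ^+ l)) invrN (exprNn l%:R^-1) (exprVn l%:R) (exprVn z).
have zm : z ^+ m != 0 by rewrite expf_neq0.
have zl : z ^+ l != 0 by rewrite expf_neq0.
have l0 : (l%:R : C) ^+ e != 0 by rewrite expf_neq0 // pnatr_eq0 -lt0n.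
by field; rewrite l0 zl zm.
Qed.

(** The regular part of lattice_factor at m, divided by (z ^+ m)^-1, the
    coefficient of its singular part. *)
Definition lattice_tail (p : nat) (z : C) (E M m : nat) : {poly C} :=
  z ^+ m *: \sum_(l < M.+1 | l != m :> nat) (z ^+ l)^-1 *: geom E (m%:R - l%:R) ^+ p.

Lemma local_lattice M E p (z : C) m : z != 0 ->
  local_factor M E (lattice_factor p z) m =
  (z ^+ m)^-1 *: (1 + 'X^p * lattice_tail p z E M m).
Proof.
move=> z0; rewrite /local_factor /lattice_tail /= scalerDr alg_polyC; congr (_ + _).
by rewrite -scalerAr scalerA mulVf ?scale1r // expf_neq0.
Qed.

Lemma coef_lattice_tail p (z : C) E M m k : z != 0 -> (m <= M)%N ->
  (lattice_tail p z E M m)`_k = (geom_coef E p k)%:~R *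
    (inner_sum false (p + k) z m + (-1) ^+ (p + k) * inner_sum false (p + k) z^-1 (M - m)).
Proof.
move=> z0 mM; rewrite -sum_other_poles // coefZ coef_sum mulrCA; congr (_ * _).
rewrite mulr_sumr; apply: eq_bigr => l _.
by rewrite coefZ coef_geomX mulrCA.
Qed.

End LocalExpansions.

Section PoleSide.
Variables (R : realType) (K : set R[i]) (r : nat).
Local Notation C := R[i].
Hypotheses (K_div : divring_closed (mem K)) (r0 : (0 < r)%N).
Variables (p : 'I_r -> nat) (q : nat) (xs : 'I_r -> C) (x : C).
Hypotheses (p_xs : forall j, convergent (p j, xs j)) (q_x : convergent (q, x)).
Hypotheses (Kx : K x) (Kxs : forall j, K (xs j)).

(** One inner sum comes from the poles below m; the poles above m give a sum of
    length M - m, which has a fast limit since it is convergent. *)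
Lemma lattice_tail_pfilt E j : pfilt K r 2 (lattice_tail (p j) (xs j) E).
Proof.
have [[/= pj0 xj] _] := p_xs j; move=> k.
have pk0 : is_letter ((p j + k)%N, xs j) by split; rewrite //= addn_gt0 pj0.
have cV := convergentV k (p_xs j).
have fV := fast_inner_sum false (phi := fun M n => (M - n)%N) cV (fun _ _ _ => leqnn _).
have sV : prodspan K r false (euler_lim false [::] (p j + k) (xs j)^-1).
  by apply: (@prodspan_weak _ _ _ true); exact: euler_lim_span.
have Kc : prodspan K r false (geom_coef E (p j) k)%:~R.
  by apply: prodspanK; exact: subfield_int.
have Ks : prodspan K r false ((-1) ^+ (p j + k)).
  by apply: prodspanK; exact: subfield_sign.
have f2 := filtZ K_div Ks (filt_le (leqnSn 1) (filt_fast false fV sV)).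
have f1 := filtD (filt_letter r K_div false pk0) f2.
apply: filt_ext (filtZ K_div Kc f1) _ => M n n0 nM.
by rewrite coef_lattice_tail // root_of_unity_neq0.
Qed.

Lemma lattice_tail_cvg E j k :
  prodspan_cvg K r (fun M => (lattice_tail (p j) (xs j) E M 0)`_k).
Proof.
have [[/= pj0 xj] _] := p_xs j; have cV := convergentV k (p_xs j).
exists ((geom_coef E (p j) k)%:~R * ((-1) ^+ (p j + k) *
   euler_lim false [::] (p j + k) (xs j)^-1)).
  apply: prodspanZ => //; first exact: subfield_int.
  apply: prodspanZ => //; first by exact: subfield_sign.
  by apply: (@prodspan_weak _ _ _ true); exact: euler_lim_span.
have -> : (fun M => (lattice_tail (p j) (xs j) E M 0)`_k) =
   fun M => (geom_coef E (p j) k)%:~R * ((-1) ^+ (p j + k) *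
      inner_sum false (p j + k) (xs j)^-1 M).
  apply/funext => M; rewrite coef_lattice_tail ?root_of_unity_neq0 //.
  by rewrite inner_sum0 add0r subn0.
by apply/tendsZ/tendsZ/inner_sum_cvg.
Qed.

Definition factors : seq (factor_data C) :=
  origin_factor R q :: [seq lattice_factor (p j) (xs j) | j <- enum 'I_r].

Definition order_sum : nat := (q + \sum_(j < r) p j)%N.

Definition total_arg : C := x * \prod_(j < r) xs j.

Lemma factors_order : (\sum_(f <- factors) f.1 = order_sum)%N.
Proof. by rewrite big_cons big_map big_enum. Qed.

(** The coefficient of (s - m)^-(order_sum - i) in the principal part at m. *)
Definition principal_coef (M m i : nat) : C :=
  (\prod_(f <- factors) local_factor M order_sum f m)`_i.

Lemma prod_local M m : (m <= M)%N ->
  \prod_(f <- factors) local_factor M order_sum f m =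
  (\prod_(j < r) (xs j ^+ m)^-1) *:
  ((if m == 0%N then 1 else 'X^q * geom order_sum (m%:R : C) ^+ q) *
   \prod_(j <- enum 'I_r) (1 + 'X^(p j) * lattice_tail (p j) (xs j) order_sum M m)).
Proof.
move=> mM; rewrite big_cons local_origin // big_map scalerAr; congr (_ * _).
rewrite !big_enum /= -scaler_prod; apply: eq_bigr => j _.
by rewrite local_lattice //; case: (p_xs j) => [[_ /root_of_unity_neq0]].
Qed.

(** The bilateral sum, evaluated pole by pole. *)
Definition residue_sum (M : nat) : C :=
  \sum_(m < M.+1) \sum_(i < order_sum)
    principal_coef M m i * (total_arg ^+ m * kappa total_arg (order_sum - i)).

Lemma total_root : is_root_of_unity total_arg.
Proof.
apply: root_of_unityM; first by case: q_x => [[]].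
elim/big_ind: _ => [|a b|j _]; [exact: root_of_unity1|exact: root_of_unityM|].
by case: (p_xs j) => [[]].
Qed.

Lemma principal0_cvg i : prodspan_cvg K r (fun M => principal_coef M 0 i).
Proof.
have -> : (fun M => principal_coef M 0 i) = fun M => (\prod_(j <- enum 'I_r)
    (1 + 'X^(p j) * lattice_tail (p j) (xs j) order_sum M 0))`_i.
  apply/funext => M; rewrite /principal_coef prod_local // eqxx mul1r coefZ.
  by rewrite big1 ?mul1r // => j _; rewrite expr0 invr1.
apply: prodspan_cvg_coef_prod => // j k.
under eq_fun do rewrite coefD coefXnM.
apply: prodspan_cvgD.
  apply: prodspan_cvg_cst; apply: prodspanK; rewrite coef1.
  exact: (subfield_int K_div (k == 0%N)).
case: (k < p j)%N; last exact: lattice_tail_cvg.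
by apply: prodspan_cvg_cst; exact: prodspan0.
Qed.

(** At m > 0 the expansion of s^-q is regular: for the pole to have positive order,
    one of the r lattice factors must contribute its singular part, and the
    remaining ones give at most r - 1 inner sums. *)
Lemma principal_cvg i : (i < order_sum)%N -> exists2 v, prodspan K r true v &
  tends (fun M => \sum_(1 <= m < M.+1) total_arg ^+ m * principal_coef M m i) v.
Proof.
move=> iE; have [A [B [fA _ AB]]] := pfilt_prod K_div (enum 'I_r) p
  (lattice_tail_pfilt order_sum).
rewrite size_enum_ord in fA.
have eqS M m : (0 < m)%N -> (m <= M)%N -> total_arg ^+ m * principal_coef M m i =
   \sum_(k < (i - q).+1) (if (i < q)%N then 0 else
      (geom_coef order_sum q k)%:~R *
      (x ^+ m / (m%:R - offset R false) ^+ (q + k) * (A M m)`_(i - q - k))).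
  move=> m0 mM; rewrite /principal_coef prod_local // gtn_eqF // coefZ mulrA.
  have -> : total_arg ^+ m * \prod_(j < r) (xs j ^+ m)^-1 = x ^+ m.
    rewrite /total_arg exprMn -prodrXl -mulrA -big_split /= big1 ?mulr1 // => j _.
    by rewrite mulfV // expf_neq0 //; case: (p_xs j) => [[_ /root_of_unity_neq0]].
  have -> : 'X^q * geom order_sum (m%:R : C) ^+ q *
      \prod_(j <- enum 'I_r) (1 + 'X^(p j) * lattice_tail (p j) (xs j) order_sum M m) =
    'X^q * (geom order_sum m%:R ^+ q * A M m) +
    'X^order_sum * (geom order_sum m%:R ^+ q * B M m).
    by rewrite AB big_enum /order_sum exprD; ring.
  rewrite coefD [in X in _ + X]coefXnM iE addr0.
  rewrite coefXnM; case: ifP => _; first by rewrite big1 ?mulr0.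
  rewrite coefM mulr_sumr; apply: eq_bigr => k _.
  by rewrite coef_geomX offset_false exprVn; ring.
have [iq|qi] := ltnP i q.
  exists 0; first exact: prodspan0.
  have -> : (fun M => \sum_(1 <= m < M.+1) total_arg ^+ m * principal_coef M m i) = fun=> 0.
    apply/funext => M; rewrite big_nat big1 // => m /andP[m1 mM].
    by rewrite eqS // iq big1.
  exact: tends_cst.
have lim (k : 'I_(i - q).+1) : exists v, prodspan K r true v /\
   tends (fun M => \sum_(1 <= m < M.+1) x ^+ m / (m%:R - offset R false) ^+ (q + k)
       * (A M m)`_(i - q - k)) v.
  have [|v sv tv] := @filt_limit _ _ _ K_div false _ _ (q + k) x (fA (i - q - k)%N) (leqnn _).
    have [[/= q0 x1] qx] := q_x; split; first by split=> //; rewrite addn_gt0 q0.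
    by case=> /eqP qk x1'; apply: qx; rewrite x1'; congr (_, _); move: qk q0; lia.
  by exists v.
have [v Hv] := choice lim.
exists (\sum_(k < (i - q).+1) (geom_coef order_sum q k)%:~R * v k).
  apply: prodspan_sum => k _; apply: prodspanZ => //; first exact: subfield_int.
  by case: (Hv k).
have -> : (fun M => \sum_(1 <= m < M.+1) total_arg ^+ m * principal_coef M m i) =
  fun M => \sum_(k < (i - q).+1) (geom_coef order_sum q k)%:~R *
    \sum_(1 <= m < M.+1) x ^+ m / (m%:R - offset R false) ^+ (q + k)
       * (A M m)`_(i - q - k).
  apply/funext => M; under [RHS]eq_bigr do rewrite mulr_sumr.
  rewrite [RHS]exchange_big /=; apply: eq_big_nat => m /andP[m1 mM].
  by rewrite eqS // ltnNge qi.
by apply: tends_sum => k _; apply: tendsZ; case: (Hv k).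
Qed.

(** Each kappa is a combination of sums of order 0, so it already makes the
    contribution of the pole at the origin, which may be constant otherwise, a
    combination of products. *)
Lemma residue_sum_cvg : exists2 v, prodspan K r true v & tends residue_sum v.
Proof.
have Ktot : K total_arg by apply: subfieldM => //; exact: subfield_prod.
have kap (i : 'I_order_sum) : prodspan K r true (kappa total_arg (order_sum - i)).
  by apply: kappa_span => //; split; [rewrite /= subn_gt0 | exact: total_root].
have lim (i : 'I_order_sum) : exists v, prodspan K r true v /\
   tends (fun M => kappa total_arg (order_sum - i) * (principal_coef M 0 i +
      \sum_(1 <= m < M.+1) total_arg ^+ m * principal_coef M m i)) v.
  have [v0 s0 t0] := principal0_cvg i.
  have [v1 s1 t1] := principal_cvg (ltn_ord i).
  exists (kappa total_arg (order_sum - i) * (v0 + v1)); split.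
    apply: (prodspanM K_div (kap i)); apply: prodspanD s0 _; exact: prodspan_weak s1.
  by apply/tendsZ/tendsD.
have [v Hv] := choice lim.
exists (\sum_(i < order_sum) v i).
  by apply: prodspan_sum => i _; case: (Hv i).
have -> : residue_sum = fun M => \sum_(i < order_sum)
    kappa total_arg (order_sum - i) * (principal_coef M 0 i +
      \sum_(1 <= m < M.+1) total_arg ^+ m * principal_coef M m i).
  apply/funext => M; rewrite /residue_sum exchange_big /=; apply: eq_bigr => i _.
  rewrite -(big_mkord xpredT (fun m => principal_coef M m i * (total_arg ^+ m * _))).
  rewrite big_ltn // expr0 mul1r mulrDr mulr_sumr; congr (_ + _).
    exact: mulrC.
  by apply: eq_bigr => m _; ring.
by apply: tends_sum => i _; case: (Hv i).
Qed.

End PoleSide.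

(** * The sum over the half-integers *)

Section BothSides.
Variables (R : realType) (K : set R[i]) (r : nat).
Local Notation C := R[i].
Local Notation harm := (harm R).
Hypotheses (K_div : divring_closed (mem K)) (r0 : (0 < r)%N).
Variables (p : 'I_r -> nat) (q : nat) (xs : 'I_r -> C) (x : C).
Hypotheses (p_xs : forall j, convergent (p j, xs j)) (q_x : convergent (q, x)).
Hypotheses (Kx : K x) (Kxs : forall j, K (xs j)).

(** The rational function is evaluated at half-integers, away from its poles. *)
Lemma half_integer_neq (n : int) (m : nat) : n%:~R - 2^-1 != m%:R :> C.
Proof.
apply/eqP => h; have : (2 * n - 1 - 2 * m%:Z)%:~R = 0 :> C.
  rewrite !rmorphB !rmorphM /= -!pmulrn -h.
  by field.
by move=> /eqP; rewrite intr_eq0 => /eqP; lia.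
Qed.

Definition summand (M : nat) (n : int) : C :=
  total_arg xs x ^ n * \prod_(f <- factors p q xs) factor_val M f (n%:~R - 2^-1).

Lemma bilateral_summand M :
  tends (bilateral (summand M)) (residue_sum p q xs x M).
Proof.
have sE n : summand M n = \sum_(m < M.+1) \sum_(i < order_sum p q)
    principal_coef p q xs M m i * pole_term (total_arg xs x) (order_sum p q - i) m n.
  rewrite /summand partial_fractions.
  - rewrite factors_order mulr_sumr; apply: eq_bigr => m _.
    by rewrite mulr_sumr; apply: eq_bigr => i _; rewrite /pole_term mulrCA.
  - by [].
  - apply/allP => f; rewrite inE => /orP[/eqP ->|/mapP[j _ ->]] /=.
      by case: q_x => [[]].
    by case: (p_xs j) => [[]].
  - by move=> m; exact: half_integer_neq.
have -> : bilateral (summand M) = fun N => \sum_(m < M.+1) \sum_(i < order_sum p q)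
    principal_coef p q xs M m i *
    bilateral (pole_term (total_arg xs x) (order_sum p q - i) m) N.
  apply/funext => N; rewrite /bilateral.
  transitivity (\sum_(1 <= n < N.+1) \sum_(m < M.+1) \sum_(i < order_sum p q)
     principal_coef p q xs M m i * (pole_term (total_arg xs x) (order_sum p q - i) m n%:Z +
       pole_term (total_arg xs x) (order_sum p q - i) m (1 - n%:Z))).
    apply: eq_bigr => n _; rewrite !sE -big_split; apply: eq_bigr => m _ /=.
    by rewrite -big_split; apply: eq_bigr => i _ /=; rewrite mulrDr.
  rewrite exchange_big; apply: eq_bigr => m _ /=.
  by rewrite exchange_big; apply: eq_bigr => i _ /=; rewrite mulr_sumr.
apply: tends_sum => m _; apply: tends_sum => i _; apply: tendsZ.
apply: bilateral_pole; first by rewrite subn_gt0.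
exact: (total_root p_xs q_x).
Qed.

Lemma summandE M n : summand M n =
  x ^ n / (n%:~R - 2^-1) ^+ q * \prod_(j < r) window (p j) (xs j) M n.
Proof.
rewrite /summand /factors big_cons big_map factor_val_origin big_enum /=.
rewrite /total_arg expfzMl mulrACA; congr (_ * _).
have -> : (\prod_(j < r) xs j) ^ n = \prod_(j < r) (xs j ^ n).
  apply: (big_morph (fun z : C => z ^ n)); last exact: exp1rz.
  by move=> a b; rewrite expfzMl.
by rewrite -big_split /=; apply: eq_bigr.
Qed.

(** For 0 < n <= M the window splits at 0 into an inner sum of length n and a sum
    with a fast limit. *)
Lemma positive_side : exists2 v, prodspan K r true v &
  tends (fun M => \sum_(1 <= n < M.+1) summand M n%:Z)
    (euler_lim true (letters p xs) q x + v).
Proof.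
pose u j (M n : nat) := inner_sum true (p j) (xs j) n.
pose w j (M n : nat) := (-1) ^+ p j * xs j * inner_sum true (p j) (xs j)^-1 (M - n).+1.
have fu j : filt K r true 2 (u j).
  by apply: filt_letter => //; case: (p_xs j).
have fw j : filt K r true 1 (w j).
  apply: filtZ => //.
    apply: prodspanK; apply: subfieldM => //; exact: subfield_sign.
  have cV := convergentV 0 (p_xs j); rewrite addn0 in cV.
  apply: (filt_fast true (fast_inner_sum true (phi := fun M n => (M - n).+1) cV _)).
    by move=> M n _; exact: leqnSn.
  by apply: (@prodspan_weak _ _ _ true); exact: euler_lim_span.
have := filt_prod_lead K_div (enum 'I_r) fu fw.
rewrite size_enum_ord => fuw.
have [v sv tv] := filt_limit K_div fuw (leqnn r) q_x.
exists v; first exact: sv.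
have tT := euler_part_cvg (b := true) (l := letters p xs) (q := q) (x := x).
have {}tT := tT _ q_x.
have -> : (fun M => \sum_(1 <= n < M.+1) summand M n%:Z) = fun M =>
   euler_part true (letters p xs) q x M + \sum_(1 <= n < M.+1)
     x ^+ n / (n%:R - offset R true) ^+ q *
     (\prod_(i <- enum 'I_r) (u i M n + w i M n) - \prod_(i <- enum 'I_r) u i M n).
  apply/funext => M; rewrite /euler_part -big_split /=; apply: eq_big_nat => n /andP[n1 nM].
  rewrite inner_prod_letters !big_enum /= summandE.
  under [in LHS]eq_bigr => j _.
    rewrite window_pos //; last by case: (p_xs j) => [[_ /root_of_unity_neq0]].
    over.
  rewrite -exprnP -pmulrn /u /w; ring.
apply: tendsD tv; apply: tT => t /mapP[j _ ->].
by case: (p_xs j).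
Qed.

(** At 1 - n the window is the difference of a sum with a fast limit and an inner
    sum of length n - 1, which is completed to length n. *)
Lemma negative_side : exists2 v, prodspan K r true v &
  tends (fun M => \sum_(1 <= n < M.+1) summand M (1 - n%:Z))
    ((-1) ^+ q * x * (\prod_(j < r) (- ((-1) ^+ p j * xs j)) *
       euler_lim true (letters p (fun j => (xs j)^-1)) q x^-1) + v).
Proof.
pose c j : C := (-1) ^+ p j * xs j.
have cK j : K (c j).
  by apply: subfieldM => //; exact: subfield_sign.
pose u j (M n : nat) := - c j * inner_sum true (p j) (xs j)^-1 n.
pose w j (M n : nat) := c j *
  ((xs j)^-1 ^+ n / (n%:R - offset R true) ^+ p j + inner_sum true (p j) (xs j)^-1 (n + M)).
have cV j : convergent (p j, (xs j)^-1) by have := convergentV 0 (p_xs j); rewrite addn0.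
have fu j : filt K r true 2 (u j).
  apply: filtZ => //; first by apply: prodspanK; exact: subfieldN.
  by apply: filt_letter => //; case: (cV j).
have fw j : filt K r true 1 (w j).
  apply: filtZ => //; first exact: prodspanK.
  apply: filtD; first by apply: filt_power => //; case: (cV j).
  apply: (filt_fast true (fast_inner_sum true (phi := fun M n => (n + M)%N) (cV j) _)).
    by move=> M n _; rewrite (leq_trans (leq_subr _ _)) ?leq_addl.
  by apply: (@prodspan_weak _ _ _ true); exact: euler_lim_span.
have q_xV : convergent (q, x^-1) by have := convergentV 0 q_x; rewrite addn0.
have := filt_prod_lead K_div (enum 'I_r) fu fw.
rewrite size_enum_ord => fuw.
have [v sv tv] := filt_limit K_div fuw (leqnn r) q_xV.
exists ((-1) ^+ q * x * v).
  by apply: prodspanZ => //; apply: subfieldM => //; exact: subfield_sign.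
rewrite -mulrDr.
have tT := euler_part_cvg (b := true) (l := letters p (fun j => (xs j)^-1))
  (q := q) (x := x^-1).
have {}tT := tT _ q_xV.
have -> : (fun M => \sum_(1 <= n < M.+1) summand M (1 - n%:Z)) = fun M =>
   (-1) ^+ q * x * (\prod_(j < r) (- c j) *
      euler_part true (letters p (fun j => (xs j)^-1)) q x^-1 M +
    \sum_(1 <= n < M.+1) x^-1 ^+ n / (n%:R - offset R true) ^+ q *
     (\prod_(i <- enum 'I_r) (u i M n + w i M n) - \prod_(i <- enum 'I_r) u i M n)).
  apply/funext => M; rewrite /euler_part mulr_sumr -big_split mulr_sumr /=.
  apply: eq_big_nat => -[//|n] _.
  rewrite inner_prod_letters !big_enum /= summandE.
  have -> : \prod_(j < r) window (p j) (xs j) M (1 - n.+1%:Z) =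
      \prod_(j < r) (u j M n.+1 + w j M n.+1).
    apply: eq_bigr => j _; rewrite window_neg; last first.
      by case: (p_xs j) => [[_ /root_of_unity_neq0]].
    by rewrite /u /w inner_sumS -/(c j); ring.
  have -> : \prod_(j < r) u j M n.+1 =
      \prod_(j < r) (- c j) * \prod_(j < r) inner_sum true (p j) (xs j)^-1 n.+1.
    by rewrite -big_split.
  have -> : (1 - n.+1%:Z)%:~R - 2^-1 = - (n.+1%:R - 2^-1) :> C.
    rewrite rmorphB /= -pmulrn; by field.
  rewrite (exprNn (n.+1%:R - 2^-1)) invfM -exprVn invrN invr1.
  rewrite expfzDr; last by case: q_x => [[_ /root_of_unity_neq0]].
  rewrite expr1z -exprnN exprVn; ring.
apply: tendsZ; apply: tendsD tv; apply: tendsZ; apply: tT => t /mapP[j _ ->].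
by case: (cV j).
Qed.

Lemma prod_le (a : 'I_r -> C) (B : 'I_r -> R) (t : R) :
  0 <= t -> t <= 1 -> (forall j, 0 <= B j) -> (forall j, normc (a j) <= B j * t) ->
  normc (\prod_(j < r) a j) <= (\prod_(j < r) B j) * t.
Proof.
move=> t0 t1 B0 aB; rewrite normc_prod.
apply: (@le_trans _ _ (\prod_(j < r) (B j * t))).
  by apply: ler_prod => j _; rewrite normc_ge0 aB.
rewrite big_split /= prodr_const card_ord; apply: ler_wpM2l.
  by apply: prodr_ge0.
by rewrite -(prednK r0) exprS ler_piMr // exprn_ile1.
Qed.

(** Beyond M the window of n lies on one side of 0, at a distance of at least
    |n| - M, so that its sums are small; one of the r factors gives the bound. *)
Lemma far_summand : exists2 B : R, 0 <= B & forall M n, (M < n)%N ->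
  normc (summand M n%:Z) <= B * (n%:R^-1 * (n - M)%:R^-1) /\
  normc (summand M (1 - n%:Z)) <= B * (n%:R^-1 * (n - M)%:R^-1).
Proof.
have cV j : convergent (p j, (xs j)^-1) by have := convergentV 0 (p_xs j); rewrite addn0.
have tail (z : 'I_r -> C) : (forall j, convergent (p j, z j)) ->
    exists B : 'I_r -> R, forall j, 0 <= B j /\ forall n m, (n <= m)%N ->
    normc (inner_sum true (p j) (z j) m - inner_sum true (p j) (z j) n) <= B j * n.+1%:R^-1.
  move=> pz; suff lim j : exists B : R, 0 <= B /\ forall n m, (n <= m)%N ->
    normc (inner_sum true (p j) (z j) m - inner_sum true (p j) (z j) n) <= B * n.+1%:R^-1.
    by have [B HB] := choice lim; exists B.
  by have [B B0 HB] := inner_sum_tail true (pz j); exists B.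
have [B1 HB1] := tail _ p_xs; have [B2 HB2] := tail _ cV.
have [[/= q0 xr] qx] := q_x; have x1 := root_of_unity_normc xr.
have xs1 j : normc (xs j) = 1 by case: (p_xs j) => [[_ /root_of_unity_normc]].
have xs0 j : xs j != 0 by case: (p_xs j) => [[_ /root_of_unity_neq0]].
have b1 j : 0 <= B1 j by case: (HB1 j).
have b2 j : 0 <= B2 j by case: (HB2 j).
pose P1 := \prod_(j < r) B1 j; pose P2 := \prod_(j < r) B2 j.
have P10 : 0 <= P1 by apply: prodr_ge0.
have P20 : 0 <= P2 by apply: prodr_ge0.
have t2 : 0 <= 2 ^+ q :> R by rewrite exprn_ge0.
exists (2 ^+ q * (P1 + P2)); first by rewrite mulr_ge0 ?addr_ge0.
move=> M [//|n] Mn.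
have nM0 : 0 < (n.+1 - M)%:R :> R by rewrite ltr0n subn_gt0.
have i0 : 0 <= (n.+1 - M)%:R^-1 :> R by rewrite invr_ge0 ltW.
have i1 : (n.+1 - M)%:R^-1 <= 1 :> R by rewrite invf_le1 // ler1n subn_gt0.
have split_bound (a b : C) P : normc a <= 2 ^+ q * n.+1%:R^-1 -> 0 <= P -> P <= P1 + P2 ->
    normc b <= P * (n.+1 - M)%:R^-1 ->
    normc (a * b) <= 2 ^+ q * (P1 + P2) * (n.+1%:R^-1 * (n.+1 - M)%:R^-1).
  move=> ha P0 PP hb; rewrite normcM.
  have -> : 2 ^+ q * (P1 + P2) * (n.+1%:R^-1 * (n.+1 - M)%:R^-1) =
    (2 ^+ q * n.+1%:R^-1) * ((P1 + P2) * (n.+1 - M)%:R^-1) by ring.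
  apply: ler_pM; rewrite ?normc_ge0 //; apply: le_trans hb _.
  exact: ler_wpM2r.
split; rewrite summandE.
  apply: (split_bound _ _ P1) => //; last 2 first.
  - by rewrite lerDl.
  - apply: prod_le => // j; rewrite window_far //.
    have [_ H] := HB1 j; apply: le_trans (H _ _ (leq_subr _ _)) _.
    by rewrite -subSn // subSS.
  rewrite normcM normc_exprz // mul1r -pmulrn.
  exact: (normc_offsetVX_le R true n q0).
apply: (split_bound _ _ P2) => //; last 2 first.
- by rewrite lerDr.
- apply: prod_le => // j; rewrite window_neg // !normcM normcX normcN normc1 expr1n xs1 !mul1r.
  have [_ H] := HB2 j; apply: le_trans (H n (n.+1 + M)%N _) _.
    by rewrite addSn leqW // leq_addr.
  by rewrite ler_wpM2l // lef_pV2 ?posrE ?ltr0n ?subn_gt0 // ler_nat leq_subr.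
rewrite normcM normc_exprz // mul1r.
have -> : (1 - n.+1%:Z)%:~R - 2^-1 = - (n.+1%:R - 2^-1) :> C.
  rewrite rmorphB /= -pmulrn; by field.
rewrite -exprVn invrN normcX normcN -normcX exprVn.
exact: (normc_offsetVX_le R true n q0).
Qed.

Lemma bilateral_far : exists2 B : R, 0 <= B & forall M, (0 < M)%N ->
  normc (residue_sum p q xs x M - bilateral (summand M) M) <= B * (harm M * M%:R^-1).
Proof.
have [B B0 HB] := far_summand; exists (2 * B); first by rewrite mulr_ge0.
move=> M M0; apply: (@tends_norm_le _ (bilateral (summand M)) _ _ _ M) => [|N MN].
  exact: bilateral_summand.
have -> : bilateral (summand M) N - bilateral (summand M) M =
   \sum_(M.+1 <= n < N.+1) (summand M n%:Z + summand M (1 - n%:Z)).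
  rewrite /bilateral (big_cat_nat (n := M.+1)) //=.
  by rewrite addrAC subrr add0r.
apply: le_trans (normc_sum _ _ _) _.
apply: (@le_trans _ _ (2 * B * \sum_(M.+1 <= n < N.+1) n%:R^-1 * (n - M)%:R^-1)); last first.
  by rewrite ler_wpM2l ?mulr_ge0 // sum_inv_tail.
rewrite mulr_sumr; apply: ler_sum_nat => n /andP[Mn _].
have [h1 h2] := HB M n Mn; apply: le_trans (le_normcD _ _) _.
apply: le_trans (lerD h1 h2) _; set t := n%:R^-1 * _.
by have -> : 2 * B * t = B * t + B * t by ring.
Qed.

(** Truncating the sum over n at the same M as the factors of the rational function
    does not change the limit. *)
Lemma bilateral_cvg : exists2 v, prodspan K r true v &
  tends (fun M => bilateral (summand M.+1) M.+1) v.
Proof.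
have [v sv tv] := residue_sum_cvg K_div r0 p_xs q_x Kx Kxs.
have [B B0 HB] := bilateral_far.
exists v; first exact: sv.
rewrite -[v]subr0.
have -> : (fun M => bilateral (summand M.+1) M.+1) = fun M => residue_sum p q xs x M.+1 -
    (residue_sum p q xs x M.+1 - bilateral (summand M.+1) M.+1).
  by apply/funext => M; rewrite opprB addrC subrK.
apply: tendsB.
  by have := tends_shift 1 tv; under eq_fun do rewrite addn1.
have small := harm_pow_over_cvg0 (2 * B) 1.
rewrite -(cvg_shiftn 1) /= in small.
apply: tends_squeeze small => M; rewrite subr0 addn1.
apply: le_trans (HB M.+1 isT) _.
have -> : 2 * B * (harm M.+1 ^+ 1 * M.+2%:R^-1) = B * (harm M.+1 * (2 * M.+2%:R^-1)).
  by rewrite expr1; ring.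
rewrite ler_wpM2l // ler_wpM2l ?harm_ge0 //.
rewrite -[leRHS]invrK invfM invrK lef_pV2 ?posrE ?mulr_gt0 ?invr_gt0 ?ltr0n //.
by rewrite mulrC ler_pdivrMr // -natrM ler_nat; lia.
Qed.

End BothSides.

(** * The parity theorem *)

Section Qadjoin.
Variables (R : realType) (A : set R[i]).

Lemma Qadjoin_divring : divring_closed (mem (Qadjoin A)).
Proof.
split=> [|a b /set_mem Ka /set_mem Kb|a b /set_mem Ka /set_mem Kb]; apply/mem_set => K KA.
- by have [[/set_mem]] := KA.
- by have [[_ Ks _] _] := KA; apply/set_mem/Ks; apply/mem_set; [exact: Ka|exact: Kb].
- by have [[_ _ Kd] _] := KA; apply/set_mem/Kd; apply/mem_set; [exact: Ka|exact: Kb].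
Qed.

Lemma Qadjoin_sub : A `<=` Qadjoin A.
Proof. by move=> a Aa K [_]; exact. Qed.

End Qadjoin.

Theorem theorem1p1 (R : realType) (r : nat) (p : 'I_r -> nat) (q : nat)
    (xs : 'I_r -> R[i]) (x : R[i])
    (r_ge1 : (1 <= r)%N)
    (x_root : is_root_of_unity x) (xs_root : forall j, is_root_of_unity (xs j))
    (p_ge1 : forall j, (1 <= p j)%N) (q_ge1 : (1 <= q)%N)
    (p_xs_neq : forall j, (p j, xs j) <> (1%N, 1))
    (q_x_neq : (q, x) <> (1%N, 1)) :
  eqmod_products (Qadjoin (x |` range xs)) r
    (euler_T p q xs x)
    ((-1) ^+ (\sum_(j < r) p j + q + r - 1)%N * (x * \prod_(j < r) xs j)
     * euler_T p q (fun j => (xs j)^-1) x^-1).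
Proof.
set K := Qadjoin _.
have K_div : divring_closed (mem K) by exact: Qadjoin_divring.
have Kx : K x by apply: Qadjoin_sub; left.
have Kxs j : K (xs j) by apply: Qadjoin_sub; right; exists j.
have p_xs j : convergent (p j, xs j) := conj (conj (p_ge1 j) (xs_root j)) (@p_xs_neq j).
have q_x : convergent (q, x) := conj (conj q_ge1 x_root) q_x_neq.
apply: prodspan_eqmod => //; rewrite !euler_TE.
have [v sv tv] := bilateral_cvg K_div r_ge1 p_xs q_x Kx Kxs.
have [v1 s1 t1] := positive_side K_div r_ge1 p_xs q_x Kxs.
have [v2 s2 t2] := negative_side K_div r_ge1 p_xs q_x Kx Kxs.
have bE : (fun M => bilateral (summand p q xs x M.+1) M.+1) =
    (fun M => \sum_(1 <= n < (M + 1).+1) summand p q xs x (M + 1) n%:Z +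
      \sum_(1 <= n < (M + 1).+1) summand p q xs x (M + 1) (1 - n%:Z)).
  by apply/funext => M; rewrite addn1 /bilateral big_split.
rewrite bE in tv.
have := tends_unique tv (tends_shift 1 (tendsD t1 t2)).
set T := euler_lim _ _ _ _; set T' := euler_lim _ _ _ _.
have -> : \prod_(j < r) (- ((-1) ^+ p j * xs j)) =
    (-1) ^+ r * (-1) ^+ (\sum_(j < r) p j) * \prod_(j < r) xs j.
  rewrite prodrN card_ord big_split /= mulrA; congr (_ * _ * _).
  by rewrite prodrXr.
have -> : (-1) ^+ (\sum_(j < r) p j + q + r - 1) =
   - ((-1) ^+ q * ((-1) ^+ r * (-1) ^+ (\sum_(j < r) p j))) :> R[i].
  rewrite -!exprD -[RHS]mulN1r -exprS -signr_odd -[RHS]signr_odd; congr (_ ^+ (_ : bool)).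
  rewrite (_ : (q + (r + \sum_(j < r) p j)).+1 =
    (\sum_(j < r) p j + q + r - 1) + 2)%N; last by lia.
  by rewrite oddD addbF.
move=> vE.
have -> : T - - ((-1) ^+ q * ((-1) ^+ r * (-1) ^+ (\sum_(j < r) p j))) *
    (x * \prod_(j < r) xs j) * T' = v - v1 - v2.
  by rewrite vE; ring.
by apply: prodspanB => //; exact: prodspanB.
Qed.
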